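(* Let $a,b$ be two distinct points of $\mathbb{P}^1(F_\infty)$, let $z\in\Omega$ and let $p=\lambda(z)\in\mathcal{T}(\mathbb{R})$. Then the valuation $\mathrm{ord}_z\,s(z;a,b)$ is the distance from $p$ to the geodesic $[a\to b]$ in $\mathcal{T}(\mathbb{R})$.
   Context: $q$ is an odd prime power, $\pi=1/T$, $F_\infty=\mathbb{F}_q((\pi))$, $\mathcal{O}_\infty=\mathbb{F}_q[[\pi]]$; $\mathbb{C}_\infty$ is the completion of an algebraic closure of $F_\infty$; $\mathrm{ord}$ is the valuation with $\mathrm{ord}(\pi)=1$, extended to $\mathbb{C}_\infty$, and $|x|=q^{-\mathrm{ord}(x)}$. $\Omega=\mathbb{C}_\infty\setminus F_\infty$, with $\mathrm{GL}_2(F_\infty)$ acting by linear fractional transformations; $|z|_i=\inf\{|z-x|:x\in F_\infty\}$. $\mathcal{T}$ is the Bruhat–Tits tree of $\mathrm{PGL}_2(F_\infty)$: vertices are homothety classes $[L]$ of rank-two $\mathcal{O}_\infty$-lattices in the row space $F_\infty^2$, adjacent if they have representatives with $\pi L\subset L'\subset L$ (strict); $\gamma[L]=[L\gamma^{-1}]$. $v_n=[\pi^n\mathcal{O}_\infty f_1+\mathcal{O}_\infty f_2]$, with $f_1,f_2$ the canonical basis. Ends of $\mathcal{T}$ are identified $\mathrm{GL}_2(F_\infty)$-equivariantly with $\mathbb{P}^1(F_\infty)$, $(v_n)_{n\geqslant 0}$ representing $\infty$ and $(v_{-n})_{n\geqslant0}$ representing $0$. $[a\to b]$ is the geodesic from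 $a$ to $b$, viewed in the geometric realization $\mathcal{T}(\mathbb{R})$ (edges of length 1, path metric). The building map $\lambda\colon\Omega\to\mathcal{T}(\mathbb{R})$ is the unique $\mathrm{GL}_2(F_\infty)$-equivariant map with $\lambda^{-1}((1-t)v_0+tv_{-1})=\{z\in\mathbb{C}_\infty:|z|=|z|_i=q^{-t}\}$ for $t\in[0,1]\cap\mathbb{Q}$; its image is the set of points with rational barycentric coordinates. $s(z;a,b)=\left(\frac1{z-b}-\frac1{z-a}\right)\mathrm{d}z$ with $\frac1{z-\infty}=0$. For a $k$-form $\omega=g(z)(\mathrm{d}z)^k$ on $\Omega$, $\mathrm{ord}_z(\omega)=\mathrm{ord}\,g(z)-k\log_q|z|_i$ (here $k=1$). *)

(* Defs.v *)
From HB Require Import structures.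
From mathcomp Require Import all_boot all_order all_algebra.
From mathcomp Require Import all_classical all_reals all_analysis.
From mathcomp Require Import zify.

Set Implicit Arguments.
Unset Strict Implicit.
Unset Printing Implicit Defensive.

Import Order.TTheory GRing.Theory Num.Theory.
Local Open Scope classical_set_scope.
Local Open Scope ring_scope.

Section Laurent.
Variable k : fieldType.
Implicit Types f g h : int -> k.

Definition vanish_below f (N : int) : Prop := forall n, n < N -> f n = 0.

Definition laurent_pred : pred (int -> k) :=
  fun f => `[< exists N, vanish_below f N >].

(* k((pi)): the function n |-> coefficient of pi^n. *)
Record laurent := Laurent { coefL :> int -> k; _ : laurent_pred coefL }.

HB.instance Definition _ := [isSub for coefL].
HB.instance Definition _ := [Equality of laurent by <:].
HB.instance Definition _ := [Choice of laurent by <:].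

Lemma laurent_bounded (x : laurent) : exists N, vanish_below x N.
Proof. by case: x => f /= /asboolP. Qed.

Lemma laurentP (x y : laurent) : (forall n, x n = y n) -> x = y.
Proof. by move=> xy; apply/val_inj/funext. Qed.

Lemma zmod_laurent : zmod_closed laurent_pred.
Proof.
split; first by apply/asboolP; exists 0.
move=> f g /asboolP[N Nf] /asboolP[M Mg]; apply/asboolP.
exists (Num.min N M) => n; rewrite lt_min => /andP[nN nM].
by rewrite !fctE Nf// Mg// subrr.
Qed.

HB.instance Definition _ :=
  GRing.isZmodClosed.Build (int -> k) laurent_pred zmod_laurent.
HB.instance Definition _ := [SubChoice_isSubZmodule of laurent by <:].

Lemma laurentD (x y : laurent) n : (x + y) n = x n + y n.
Proof. by rewrite -[LHS]/((val (x + y)) n) raddfD. Qed.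

(* The sum has finite support when f and g vanish below some index. *)
Definition conv f g (n : int) : k := \sum_(i \in [set: int]) f i * g (n - i).

Lemma conv_vanish f g a b :
  vanish_below f a -> vanish_below g b -> vanish_below (conv f g) (a + b).
Proof.
move=> fa gb n nab; apply: fsbig1 => i _.
have [ia|ai] := ltP i a; first by rewrite fa// mul0r.
by rewrite gb ?mulr0//; lia.
Qed.

Definition truncp (a : int) (m : nat) f : {poly k} := \poly_(i < m) f (a + i%:Z).

Lemma conv_truncp f g a b m j : vanish_below f a -> vanish_below g b ->
  (j < m)%N -> conv f g (a + b + j%:Z) = (truncp a m f * truncp b m g)`_j.
Proof.
move=> fa gb jm; pose r := [seq a + i%:Z | i <- iota 0 j.+1].
rewrite /conv (fsbigE r)//; first last.
- move=> i _; have [ia|ai] := ltP i a; first by rewrite fa// mul0r.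
  move=> ir; rewrite gb ?mulr0//.
  rewrite ltNge; apply: contra ir => le_b; apply/mapP.
  by exists (absz (i - a)); rewrite ?mem_iota; lia.
- by rewrite map_inj_uniq ?iota_uniq// => u v; lia.
rewrite big_map coefM -(big_mkord xpredT
  (fun i => (truncp a m f)`_i * (truncp b m g)`_(j - i))).
rewrite /index_iota subn0 big_seq_cond [RHS]big_seq; apply: eq_big => i.
  by rewrite in_setT andbT.
rewrite in_setT andbT mem_iota add0n => /andP[_ ij].
rewrite !coef_poly (leq_trans ij jm) (leq_ltn_trans (leq_subr _ _) jm).
by congr (_ * g _); lia.
Qed.

Lemma take_poly_mull m (p q : {poly k}) j : (j < m)%N ->
  (take_poly m p * q)`_j = (p * q)`_j.
Proof.
move=> jm; rewrite !coefM; apply: eq_bigr => i _.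
by rewrite coef_take_poly (leq_ltn_trans _ jm)// -ltnS.
Qed.

Lemma trunc_conv f g a b m : vanish_below f a -> vanish_below g b ->
  truncp (a + b) m (conv f g) = take_poly m (truncp a m f * truncp b m g).
Proof.
move=> fa gb; apply/polyP => i; rewrite coef_poly coef_take_poly.
by case: ifP => // im; rewrite (@conv_truncp _ _ a b m).
Qed.

Lemma vanish_eq f g N : vanish_below f N -> vanish_below g N ->
  (forall j : nat, f (N + j%:Z) = g (N + j%:Z)) -> f =1 g.
Proof.
move=> fN gN fg n; have [nN|Nn] := ltP n N; first by rewrite fN// gN.
have -> : n = N + (absz (n - N)%R)%:Z by lia.
exact: fg.
Qed.

Lemma conv_laurent (x y : laurent) : laurent_pred (conv x y).
Proof.
have [a xa] := laurent_bounded x; have [b yb] := laurent_bounded y.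
by apply/asboolP; exists (a + b); exact: conv_vanish.
Qed.

Definition mulL (x y : laurent) : laurent := Laurent (conv_laurent x y).

Lemma monoL_subproof (n : int) : laurent_pred (fun i => (i == n)%:R).
Proof. by apply/asboolP; exists n => i /lt_eqF ->. Qed.

Definition monoL (n : int) : laurent := Laurent (monoL_subproof n).

Lemma mulLC : commutative mulL.
Proof.
move=> x y; have [a xa] := laurent_bounded x; have [b yb] := laurent_bounded y.
apply/laurentP/(@vanish_eq _ _ (a + b)) => [||j]; first exact: conv_vanish.
  by rewrite addrC; exact: conv_vanish.
rewrite /= (@conv_truncp _ _ a b j.+1)// addrC addrA [_ + a]addrC.
by rewrite addrAC [a + b]addrC (@conv_truncp _ _ b a j.+1)// mulrC.
Qed.

Lemma mulLA : associative mulL.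
Proof.
move=> x y z; have [a xa] := laurent_bounded x.
have [b yb] := laurent_bounded y; have [c zc] := laurent_bounded z.
apply/laurentP/(@vanish_eq _ _ (a + b + c)) => [||j].
- by rewrite -addrA; do 2![apply: conv_vanish => //].
- by do 2![apply: conv_vanish => //].
have vxy := conv_vanish xa yb; have vyz := conv_vanish yb zc.
have Exy := @trunc_conv _ _ _ _ j.+1 xa yb.
have Eyz := @trunc_conv _ _ _ _ j.+1 yb zc.
transitivity (truncp a j.+1 x * (truncp b j.+1 y * truncp c j.+1 z))`_j.
  rewrite -[a + b + c]addrA [LHS](@conv_truncp _ _ a (b + c) j.+1)// Eyz.
  by rewrite mulrC take_poly_mull// mulrC.
rewrite [RHS](@conv_truncp _ _ (a + b) c j.+1)// Exy.
by rewrite take_poly_mull// mulrA.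
Qed.

Lemma mulLDl : left_distributive mulL +%R.
Proof.
move=> x y z; have [a xa] := laurent_bounded x.
have [b yb] := laurent_bounded y; have [c zc] := laurent_bounded z.
pose d := Num.min a b.
have xd : vanish_below x d by move=> n; rewrite lt_min => /andP[/xa].
have yd : vanish_below y d by move=> n; rewrite lt_min => /andP[_ /yb].
have xyd : vanish_below (x + y) d.
  by move=> n nd; rewrite laurentD xd// yd// addr0.
apply/laurentP/(@vanish_eq _ _ (d + c)) => [||j]; first exact: conv_vanish.
  by move=> n nd; rewrite laurentD /= !(conv_vanish _ zc nd)// addr0.
have E : truncp d j.+1 (x + y) = truncp d j.+1 x + truncp d j.+1 y.
  apply/polyP => i; rewrite coefD !coef_poly.
  by case: ifP => _; rewrite ?laurentD ?addr0.
rewrite laurentD [LHS](@conv_truncp _ _ d c j.+1)// E mulrDl coefD.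
by rewrite -!(@conv_truncp _ _ d c j.+1).
Qed.

Lemma mul1L : left_id (monoL 0) mulL.
Proof.
move=> x; have [a xa] := laurent_bounded x.
have v0 : vanish_below (monoL 0) 0 by move=> i /lt_eqF /= ->.
apply/laurentP/(@vanish_eq _ _ a) => [||j] //.
  by rewrite -[a]add0r; exact: conv_vanish.
rewrite /= -{1}[a]add0r (@conv_truncp _ _ 0 a j.+1)//.
have -> : truncp 0 j.+1 (monoL 0) = 1.
  by apply/polyP => i; rewrite coef_poly coef1; case: i => //= i; case: ifP.
by rewrite mul1r coef_poly ltnSn.
Qed.

Lemma monoL0_neq0 : monoL 0 != 0.
Proof.
apply/eqP => /(congr1 (fun x : laurent => x 0)) /=.
by move/eqP; rewrite oner_eq0.
Qed.

HB.instance Definition _ := GRing.Zmodule_isComNzRing.Build laurent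
  mulLA mulLC mul1L mulLDl monoL0_neq0.

Lemma laurent_order (x : laurent) : x != 0 ->
  exists N, vanish_below x N /\ x N != 0.
Proof.
move=> x0; have [a xa] := laurent_bounded x.
have [j xj] : exists j : nat, x (a + j%:Z) != 0.
  apply: contrapT => nx; move/eqP: x0; apply; apply/laurentP.
  apply: (@vanish_eq _ _ a) => // j.
  by apply/eqP/negPn/negP => xj; apply: nx; exists j.
have exj : exists j : nat, x (a + j%:Z) != 0 by exists j.
case: (ex_minnP exj) => {xj exj}j xj jmin; exists (a + j%:Z); split=> // n nj.
have [na|an] := ltP n a; first exact: xa.
apply/eqP/negPn/negP => xn; have /jmin : x (a + (absz (n - a)%R)%:Z) != 0.
  by apply: contraNneq xn => <-; apply/eqP; congr (x _); lia.
by lia.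
Qed.

Fixpoint inv_coefs (p : nat -> k) (n : nat) : seq k :=
  if n is n'.+1 then
    let s := inv_coefs p n' in
    rcons s (if n' is 0 then (p 0)^-1
             else - (p 0)^-1 * \sum_(i < n') p (n' - i)%N * s`_i)
  else [::].

Lemma size_inv_coefs p n : size (inv_coefs p n) = n.
Proof. by elim: n => //= n IH; rewrite size_rcons IH. Qed.

Lemma nth_inv_coefs p n m i : (i < n)%N -> (n <= m)%N ->
  (inv_coefs p m)`_i = (inv_coefs p n)`_i.
Proof.
move=> i_n; elim: m => [|m IH]; first by lia.
rewrite leq_eqVlt => /orP[/eqP->//|nm] /=.
by rewrite nth_rcons size_inv_coefs (leq_trans i_n)// IH.
Qed.

Lemma laurent_inv_exists (x : laurent) : x != 0 ->
  exists y : laurent, y * x = 1.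
Proof.
move=> /laurent_order[N [xN xN0]].
pose p j := x (N + j%:Z); have p0 : p 0 != 0 by rewrite /p addr0.
pose s j := (inv_coefs p j.+1)`_j.
pose g (n : int) := if n < - N then 0 else s (absz (n + N)).
have gN : vanish_below g (- N) by move=> n; rewrite /g => ->.
have gL : laurent_pred g by apply/asboolP; exists (- N).
have gE j : Laurent gL (- N + j%:Z) = s j.
  by rewrite /= /g ifF; [congr (s _) | apply/negbTE]; lia.
exists (Laurent gL); apply/laurentP.
have v1 : vanish_below (1 : laurent) 0 by move=> i /lt_eqF /= ->.
apply: (@vanish_eq _ _ 0) => // [|j].
  by rewrite -[X in vanish_below _ X](addNr N); exact: conv_vanish.
rewrite -{1}(addNr N) [LHS](@conv_truncp _ _ (- N) N j.+1)// coefM.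
have -> : (1 : laurent) (0 + j%:Z) = (j == 0)%:R by rewrite add0r.
have sE (i : 'I_j.+1) : s i = (inv_coefs p j.+1)`_i.
  by rewrite /s (@nth_inv_coefs p i.+1 j.+1)//; exact: ltn_ord.
under eq_bigr => i _.
  rewrite !coef_poly ltn_ord gE ltnS leq_subr.
  rewrite -/(p _) sE.
  over.
case: j sE => [|j] _; first by rewrite big_ord1 /= mulVf.
have -> : inv_coefs p j.+2 = rcons (inv_coefs p j.+1) (- (p 0)^-1 *
  \sum_(i < j.+1) p (j.+1 - i)%N * (inv_coefs p j.+1)`_i) by [].
move: (size_inv_coefs p j.+1); set t := inv_coefs p j.+1; move: t => t szt.
rewrite big_ord_recr [ord_max : nat]/= subnn nth_rcons szt ltnn eqxx.
set B := \sum_(i < j.+1) p _ * _.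
rewrite [X in X = _](_ : _ = B + - (p 0)^-1 * B * p 0).
  by rewrite mulNr mulNr mulrAC mulVf// mul1r subrr.
congr (_ + _); apply: eq_bigr => i _ /=.
by rewrite nth_rcons szt ltn_ord mulrC.
Qed.

Definition invL (x : laurent) : laurent :=
  if pselect (x != 0) is left x0 then sval (cid (laurent_inv_exists x0)) else 0.

Lemma mulVL (x : laurent) : x != 0 -> invL x * x = 1.
Proof. by rewrite /invL; case: pselect => // x0 _; case: cid. Qed.

Lemma invL0 : invL 0 = 0.
Proof.
by rewrite /invL; case: pselect => // x0; exfalso; move: x0; rewrite eqxx.
Qed.

HB.instance Definition _ := GRing.ComNzRing_isField.Build laurent mulVL invL0.

(* The uniformizer pi = 1/T. *)
Definition uniformizer : laurent := monoL 1.

Definition Oinf : set laurent := [set x | vanish_below x 0].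

End Laurent.

Section Tree.
Variable k : fieldType.
Local Notation F := (laurent k).

Definition P1 := option F.

Record GL2 := MkGL2 { GL2_mx :> 'M[F]_2; GL2_unit : GL2_mx \in unitmx }.

Lemma GL2_inv_subproof (g : GL2) : invmx g \in unitmx.
Proof. by rewrite unitmx_inv GL2_unit. Qed.

Definition GL2_inv (g : GL2) : GL2 := MkGL2 (GL2_inv_subproof g).

Definition P1_act (g : GL2) (x : P1) : P1 :=
  let: (num, den) :=
    if x is Some y then (g 0 0 * y + g 0 1, g 1 0 * y + g 1 1)
    else (g 0 0, g 1 0) in
  if den == 0 then None else Some (num / den).

Implicit Types (L : set 'rV[F]_2) (g : GL2).

(* The O-span of the rows of h. *)
Definition lattice_of (h : 'M[F]_2) : set 'rV[F]_2 :=
  [set v *m h | v in [set v : 'rV_2 | forall j, Oinf (v 0 j)]].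

Definition is_lattice L := exists2 h, h \in unitmx & L = lattice_of h.

Definition scale_lattice (c : F) L : set 'rV[F]_2 :=
  [set c *: v | v in L].

Definition homothety_class L : set (set 'rV[F]_2) :=
  [set L' | exists2 c, c != 0 & L' = scale_lattice c L].

Record vertex := MkVertex {
  vertex_class :> set (set 'rV[F]_2);
  vertex_classP : exists2 L, is_lattice L & vertex_class = homothety_class L }.

Lemma vertex_eq (u w : vertex) : u = w :> set (set 'rV[F]_2) -> u = w.
Proof.
case: u w => [A HA] [B HB] /= AB; subst B.
by congr MkVertex; exact: Prop_irrelevance.
Qed.

Definition vertex_of (h : 'M[F]_2) (hU : h \in unitmx) : vertex :=
  MkVertex (ex_intro2 _ _ (lattice_of h) (ex_intro2 _ _ h hU erefl) erefl).

Definition adjacent (u w : vertex) : Prop :=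
  exists L L', [/\ vertex_class u L, vertex_class w L',
    scale_lattice (uniformizer k) L `<` L' & L' `<` L].

(* gamma [L] = [L gamma^-1]. *)
Definition act_lattice g L : set 'rV[F]_2 := [set v *m invmx g | v in L].

Lemma act_latticeK g L : act_lattice (GL2_inv g) (act_lattice g L) = L.
Proof.
rewrite /act_lattice /= invmxK image_comp -[RHS]image_id.
by apply: eq_imagel => v _ /=; rewrite mulmxKV ?GL2_unit.
Qed.

Lemma act_latticeVK g L : act_lattice g (act_lattice (GL2_inv g) L) = L.
Proof.
rewrite /act_lattice /= invmxK image_comp -[RHS]image_id.
by apply: eq_imagel => v _ /=; rewrite mulmxK ?GL2_unit.
Qed.

Lemma act_lattice_of g h : act_lattice g (lattice_of h) = lattice_of (h *m invmx g).
Proof.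
rewrite /act_lattice /lattice_of image_comp.
by apply: eq_imagel => v _ /=; rewrite mulmxA.
Qed.

Lemma act_scale_lattice g c L :
  act_lattice g (scale_lattice c L) = scale_lattice c (act_lattice g L).
Proof.
rewrite /act_lattice /scale_lattice !image_comp.
by apply: eq_imagel => v _ /=; rewrite scalemxAl.
Qed.

Lemma act_lattice_proper g L L' :
  L `<` L' -> act_lattice g L `<` act_lattice g L'.
Proof.
move=> [LL' nL'L]; split; first exact: image_subset.
move=> /(image_subset (mulmx^~ (invmx (GL2_inv g)))).
by rewrite -!/(act_lattice _ _) !act_latticeK.
Qed.

Lemma act_vertex_subproof g (u : vertex) :
  exists2 L, is_lattice L & act_lattice g @` u = homothety_class L.
Proof.
case: u => u /= [L [h hU ->] ->]; exists (lattice_of (h *m invmx g)).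
  by exists (h *m invmx g) => //; rewrite unitmx_mul hU unitmx_inv GL2_unit.
rewrite -act_lattice_of; apply/seteqP; split => [_ [_ [c c0 ->] <-]|_ [c c0 ->]].
  by exists c => //; rewrite act_scale_lattice.
by exists (scale_lattice c (lattice_of h)); rewrite ?act_scale_lattice//; exists c.
Qed.

Definition act_vertex g (u : vertex) : vertex := MkVertex (act_vertex_subproof g u).

Lemma act_vertexK g : cancel (act_vertex g) (act_vertex (GL2_inv g)).
Proof.
move=> u; apply: vertex_eq; rewrite /= image_comp -[RHS]image_id.
by apply: eq_imagel => L _ /=; rewrite act_latticeK.
Qed.

Lemma act_vertexVK g : cancel (act_vertex (GL2_inv g)) (act_vertex g).
Proof.
move=> u; apply: vertex_eq; rewrite /= image_comp -[RHS]image_id.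
by apply: eq_imagel => L _ /=; rewrite act_latticeVK.
Qed.

Lemma act_adjacent g u w :
  adjacent u w -> adjacent (act_vertex g u) (act_vertex g w).
Proof.
move=> [L [L' [uL wL' piLL' L'L]]].
exists (act_lattice g L), (act_lattice g L'); split.
- by exists L.
- by exists L'.
- by rewrite -act_scale_lattice; exact: act_lattice_proper.
- exact: act_lattice_proper.
Qed.

Definition std_mx (n : int) : 'M[F]_2 :=
  diag_mx (\row_j (if j == 0 then (uniformizer k) ^ n else 1)).

Lemma std_mx_unit n : std_mx n \in unitmx.
Proof.
rewrite unitmxE det_diag big_ord_recl big_ord1 !mxE /= mulr1 unitfE expfz_neq0//.
apply/eqP => /(congr1 (fun x : F => x 1)) /= /eqP.
by rewrite oner_eq0.
Qed.

(* v_n = [pi^n O f_1 + O f_2]. *)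
Definition std_vertex (n : int) : vertex := vertex_of (std_mx_unit n).

(* The end of T represented by the ray r is the point x of P^1(F_oo), under the
   GL_2-equivariant identification for which (v_n)_(n >= 0) represents oo: some
   g with g oo = x is such that r and (g v_n)_n agree up to initial segments. *)
Definition ray_represents (r : nat -> vertex) (x : P1) : Prop :=
  exists2 g : GL2, P1_act g None = x &
    exists m n : nat, forall i : nat,
      r (m + i)%N = act_vertex g (std_vertex (n + i)%N%:Z).

End Tree.

Section Realization.
Variables (R : realType) (k : fieldType).
Local Notation vertex := (vertex k).
Implicit Types (u v w : vertex) (g : GL2 k) (s t l : R).

(* Barycentric coordinates of the point (1 - t) u + t w. *)
Definition edge_coord u w t : vertex -> R :=
  fun v => (1 - t) * (`[< v = u >])%:R + t * (`[< v = w >])%:R.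

(* T(R); every vertex belongs to an edge, so that the closed edges cover it. *)
Record treeR := MkTreeR {
  bary :> vertex -> R;
  baryP : exists u w t, [/\ adjacent u w, 0 <= t <= 1 & bary = edge_coord u w t] }.

Definition on_edge u w t (p : treeR) : Prop :=
  [/\ adjacent u w, 0 <= t <= 1 & bary p = edge_coord u w t].

Lemma act_point_subproof g (p : treeR) : exists u w t,
  [/\ adjacent u w, 0 <= t <= 1 &
    (fun v => p (act_vertex (GL2_inv g) v)) = edge_coord u w t].
Proof.
case: p => f /= [u [w [t [uw t01 ->]]]].
exists (act_vertex g u), (act_vertex g w), t; split=> //; first exact: act_adjacent.
have E v v' : (act_vertex (GL2_inv g) v = v') = (v = act_vertex g v').
  apply/propext; split=> [<-|->]; first by rewrite act_vertexVK.
  by rewrite act_vertexK.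
by apply/funext => v; rewrite /edge_coord /= !E.
Qed.

Definition act_point g (p : treeR) : treeR := MkTreeR (act_point_subproof g p).

(* Paths made of segments of closed edges, each edge having length 1, with the
   total length; tree_dist is the resulting path metric. *)
Inductive polygonal_path : treeR -> treeR -> R -> Prop :=
| polygonal_nil p : polygonal_path p p 0
| polygonal_cons u w s t p p' p'' l :
    on_edge u w s p -> on_edge u w t p' -> polygonal_path p' p'' l ->
    polygonal_path p p'' (`|s - t| + l).

Definition tree_dist (p p' : treeR) : R := inf [set l | polygonal_path p p' l].

Definition dist_to_set (p : treeR) (A : set treeR) : R :=
  inf [set tree_dist p p' | p' in A].

(* The map R -> T(R) sending n + t to the point (1 - t) u_n + t u_(n+1) of an
   edge is an isometric embedding. *)
Definition geodesic_line (u : int -> vertex) : Prop :=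
  (forall n, adjacent (u n) (u (n + 1))) /\
  forall m n s t p p', on_edge (u m) (u (m + 1)) s p ->
    on_edge (u n) (u (n + 1)) t p' ->
    tree_dist p p' = `|(m%:~R + s) - (n%:~R + t)|.

(* [a -> b] as a subset of T(R). *)
Definition geodesic (a b : P1 k) : set treeR :=
  [set p | exists u : int -> vertex,
    [/\ geodesic_line u,
        ray_represents (fun n => u (- n%:Z)) a,
        ray_represents (fun n => u n%:Z) b &
        exists n t, on_edge (u n) (u (n + 1)) t p]].

End Realization.

Section Omega.
Variables (k : fieldType) (C : fieldType) (iota : {rmorphism laurent k -> C}).

Record Omega := MkOmega {
  omega_val :> C; omegaP : forall x : laurent k, omega_val <> iota x }.

Definition moebius (g : GL2 k) (z : C) : C :=
  (iota (g 0 0) * z + iota (g 0 1)) / (iota (g 1 0) * z + iota (g 1 1)).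

Lemma act_Omega_subproof (g : GL2 k) (z : Omega) (x : laurent k) :
  moebius g z <> iota x.
Proof.
have detg : g 0 0 * g 1 1 - g 0 1 * g 1 0 != 0.
  have := GL2_unit g; rewrite unitmxE unitfE (expand_det_row _ 0).
  rewrite !big_ord_recl big_ord0 /cofactor !det_mx11 !mxE /= addr0.
  rewrite expr0 mul1r expr1 mulN1r mulrN.
  have -> : lift ord0 ord0 = 1 :> 'I_2 by apply/val_inj.
  by have -> : lift 1 0 = 0 :> 'I_2 by apply/val_inj.
have lin (c d : laurent k) : iota c * (z : C) + iota d = 0 -> c = 0 /\ d = 0.
  have [->|c0] := eqVneq c 0.
    by rewrite rmorph0 mul0r add0r => /eqP; rewrite fmorph_eq0 => /eqP.
  move=> /eqP; rewrite addr_eq0 mulrC => /eqP zE.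
  case: (@omegaP z (- d / c)); rewrite fmorph_div rmorphN -zE mulfK//.
  by rewrite fmorph_eq0.
rewrite /moebius => zx.
have [/lin [c0 d0]|den0] := eqVneq (iota (g 1 0) * (z : C) + iota (g 1 1)) 0.
  by move: detg; rewrite c0 d0 !mulr0 subrr eqxx.
have /lin [/eqP + /eqP] :
    iota (g 0 0 - x * g 1 0) * (z : C) + iota (g 0 1 - x * g 1 1) = 0.
  move/(congr1 ( *%R^~ (iota (g 1 0) * (z : C) + iota (g 1 1)))): zx.
  rewrite divfK// => zx.
  rewrite !rmorphB !rmorphM mulrBl addrACA zx mulrDr mulrA.
  by rewrite addrACA !subrr addr0.
rewrite !subr_eq0 => /eqP ax /eqP bx.
by move: detg; rewrite ax bx mulrAC subrr eqxx.
Qed.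

Definition act_Omega (g : GL2 k) (z : Omega) : Omega :=
  MkOmega (@act_Omega_subproof g z).

(* Coefficient g of the 1-form s(z; a, b) = g(z) dz. *)
Definition inv_diff (z : C) (a : P1 k) : C :=
  if a is Some x then (z - iota x)^-1 else 0.

Definition s_coef (a b : P1 k) (z : C) : C := inv_diff z b - inv_diff z a.

End Omega.

Section Cinf.
Variables (R : realType) (k : finFieldType) (C : fieldType).
Variables (iota : {rmorphism laurent k -> C}) (ord : C -> \bar R).

Definition q_of : R := #|k|%:R.

(* |x| = q ^ (- ord x), with |0| = 0. *)
Definition absv (x : C) : R := if ord x is r%:E then q_of `^ (- r) else 0.

Definition log_q (x : R) : R := ln x / ln q_of.

Definition abs_i (z : C) : R := inf [set absv (z - iota x) | x in [set: laurent k]].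

(* (C, ord), as an extension of F_oo through iota, is the completion C_oo of an
   algebraic closure K of F_oo, with ord the valuation such that ord pi = 1. *)
Record is_Cinf : Prop := IsCinf {
  ord_eqNy : forall x, ord x != -oo%E;
  ord_eqy : forall x, ord x = +oo%E <-> x = 0;
  ordM : forall x y, ord (x * y) = (ord x + ord y)%E;
  ordD : forall x y, (Order.min (ord x) (ord y) <= ord (x + y))%E;
  ord_laurent : forall (f : laurent k) (n : int),
    vanish_below f n -> f n != 0 -> ord (iota f) = (n%:~R)%:E;
  Cinf_complete : forall x : nat -> C,
    (forall e : R, 0 < e -> exists N, forall m n, (N <= m)%N -> (N <= n)%N ->
       absv (x m - x n) < e) ->
    exists y, forall e : R, 0 < e -> exists N, forall n, (N <= n)%N ->
      absv (x n - y) < e;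
  Cinf_algclosure : exists (K : closedFieldType)
      (i : {rmorphism laurent k -> K}) (j : {rmorphism K -> C}),
    [/\ forall x, j (i x) = iota x,
        forall y, algebraicOver i y &
        forall (x : C) (e : R), 0 < e -> exists y, absv (x - j y) < e] }.

(* By equivariance, the fibres over this one edge determine lambda. *)
Record is_building_map (lambda : Omega iota -> treeR R k) : Prop :=
  IsBuildingMap {
  building_equivariant : forall g z,
    lambda (act_Omega g z) = act_point g (lambda z);
  building_fibre : forall t : rat, 0 <= t <= 1 ->
    [set z : C | exists2 w : Omega iota, omega_val w = z &
      bary (lambda w) = edge_coord (std_vertex k 0) (std_vertex k (-1)) (ratr t)]
    = [set z : C | absv z = abs_i z /\ abs_i z = q_of `^ (- ratr t)] }.

(* The valuation at z of the n-form g(z) (dz)^n. *)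
Definition ord_form (n : nat) (g : C -> C) (z : C) : \bar R :=
  (ord (g z) - (n%:R * log_q (abs_i z))%:E)%E.

End Cinf.

(* Main.v *)
Require Import Defs.
From HB Require Import structures.
From mathcomp Require Import all_boot all_order all_algebra perm.
From mathcomp Require Import all_classical all_reals all_analysis.
From mathcomp Require Import zify ring lra.

(* Attach to a in P^1(F) the row e_a = (1, -a), or (0, 1) if a = oo, and let E
   be the matrix with rows e_a and e_b. For a vertex u = [O^2 h] put
   M = E h^-1, let r_0, r_1 be the orders of the rows of M, and
   defect u = ord det M - r_0 - r_1, gap u = r_1 - r_0.
   Along an edge exactly one of these two integers changes, and it changes by 1;
   the defect is constant only where it is 0, a vertex of positive defect has a
   neighbour of smaller defect, and the vertices of defect 0 are the E^-1 v_n,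
   n being the gap. Hence the defect is the distance to the line (E^-1 v_n)_n.
   A geodesic line u from a to b has defect 0 at u_N and u_{-N} for large N, and
   the steps from u_{-N} to u_N are all needed to change the gap, so the defect
   vanishes on u: the line (E^-1 v_n)_n is [a -> b].
   On the other side, write z = pi^m w + x with x in F nearest to z and
   0 <= ord w <= 1. Then lambda(w) lies on the edge (v_0, v_{-1}), on which the
   order of a row (u_1, u_2) interpolates to ord (u_1 w + u_2), because
   |w| = |w|_i. The defect of lambda(z) is thus
   ord det E - ord (e_a(z)) - ord (e_b(z)) + ord (z - x), where
   e_a(z) = z - a or 1. This is ord_z s(z; a, b), as
   s(z; a, b) = - det E / (e_a(z) e_b(z)) dz. *)

Set Implicit Arguments.
Unset Strict Implicit.
Unset Printing Implicit Defensive.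

Import Order.TTheory GRing.Theory Num.Theory.
Local Open Scope classical_set_scope.
Local Open Scope ring_scope.

(* MathComp-Analysis also exports a constant [adjacent]. *)
Local Notation adjacent := Defs.adjacent.

(** * Orders of Laurent series and matrices *)

Section LaurentOrder.
Variable k : fieldType.
Local Notation F := (laurent k).
Implicit Types (x y : F) (m n : int).

Lemma vanish_belowW x m n : vanish_below x n -> m <= n -> vanish_below x m.
Proof. by move=> xn mn i im; apply: xn; exact: lt_le_trans im mn. Qed.

Lemma laurent0 n : (0 : F) n = 0.
Proof. by rewrite -[LHS]/((val (0 : F)) n) raddf0. Qed.

Lemma laurentN x n : (- x) n = - x n.
Proof. by apply/eqP; rewrite -addr_eq0 -laurentD addNr laurent0. Qed.

Lemma vanish_below0 n : vanish_below (0 : F) n.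
Proof. by move=> i _; rewrite laurent0. Qed.

Lemma vanish_belowD x y n :
  vanish_below x n -> vanish_below y n -> vanish_below (x + y) n.
Proof. by move=> xn yn i i_n; rewrite laurentD xn// yn// addr0. Qed.

Lemma vanish_belowN x n : vanish_below x n -> vanish_below (- x) n.
Proof. by move=> xn i i_n; rewrite laurentN xn// oppr0. Qed.

Lemma vanish_belowB x y n :
  vanish_below x n -> vanish_below y n -> vanish_below (x - y) n.
Proof. by move=> xn yn; apply/vanish_belowD/vanish_belowN. Qed.

Lemma vanish_below_sum (I : Type) (r : seq I) (P : pred I) (f : I -> F) n :
  (forall i, P i -> vanish_below (f i) n) ->
  vanish_below (\sum_(i <- r | P i) f i) n.
Proof.
move=> fn; elim/big_rec: _ => [|i x Pi]; first exact: vanish_below0.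
by apply: vanish_belowD; exact: fn.
Qed.

Lemma vanish_belowM x y m n :
  vanish_below x m -> vanish_below y n -> vanish_below (x * y) (m + n).
Proof. exact: conv_vanish. Qed.

Lemma laurentM_lead x y m n :
  vanish_below x m -> vanish_below y n -> (x * y) (m + n) = x m * y n.
Proof.
move=> xm yn; rewrite -[m + n]addr0 -[0]/(0%N%:Z).
rewrite [LHS](@conv_truncp _ _ _ m n 1)// coefM big_ord1 !coef_poly /=.
by rewrite !addr0.
Qed.

(** At the zero series the set is empty and the order takes the default value 0. *)
Definition ordL x : int := xget 0 [set n | vanish_below x n /\ x n != 0].

Lemma ordLP x : x != 0 -> vanish_below x (ordL x) /\ x (ordL x) != 0.
Proof. by move=> /laurent_order /(xgetPex 0). Qed.

Lemma ordL_unique x n : vanish_below x n -> x n != 0 -> ordL x = n.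
Proof.
move=> xn xn0; have x0 : x != 0.
  by apply: contraNneq xn0 => ->; rewrite laurent0.
have [xo xo0] := ordLP x0; apply: le_anti; rewrite !leNgt; apply/andP; split.
  by apply/negP => /xo /eqP; rewrite (negPf xn0).
by apply/negP => /xn /eqP; rewrite (negPf xo0).
Qed.

Lemma vanish_below_ordL x n : x != 0 -> vanish_below x n <-> n <= ordL x.
Proof.
move=> x0; have [xo xo0] := ordLP x0; split=> [xn|]; last exact: vanish_belowW.
by rewrite leNgt; apply/negP => /xn/eqP; rewrite (negPf xo0).
Qed.

Lemma ordL_ge x n : x != 0 -> vanish_below x n -> n <= ordL x.
Proof. by move=> x0 xn; apply/vanish_below_ordL. Qed.

Lemma ordLM x y : x != 0 -> y != 0 -> ordL (x * y) = ordL x + ordL y.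
Proof.
move=> /ordLP[xo xo0] /ordLP[yo yo0].
apply: ordL_unique; first exact: vanish_belowM.
by rewrite laurentM_lead// mulf_neq0.
Qed.

Lemma ordL_monoL n : ordL (monoL k n) = n.
Proof. by apply: ordL_unique => [i /lt_eqF/= ->|/=]; rewrite ?eqxx ?oner_neq0. Qed.

Lemma ordL1 : ordL (1 : F) = 0.
Proof. exact: (ordL_monoL 0). Qed.

Lemma ordLN x : ordL (- x) = ordL x.
Proof.
have [->|x0] := eqVneq x 0; first by rewrite oppr0.
have [xo xo0] := ordLP x0; apply: ordL_unique; first exact: vanish_belowN.
by rewrite laurentN oppr_eq0.
Qed.

Lemma ordLV x : x != 0 -> ordL x^-1 = - ordL x.
Proof.
move=> x0; apply/eqP; rewrite -addr_eq0 -ordLM ?invr_neq0// mulVf//.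
by rewrite ordL1.
Qed.

Lemma uniformizer_neq0 : uniformizer k != 0.
Proof.
by apply/eqP => /(congr1 (fun x : F => x 1)) /= /eqP; rewrite oner_eq0.
Qed.

Lemma uniformizer_exp_neq0 n : uniformizer k ^ n != 0.
Proof. by rewrite expfz_neq0// uniformizer_neq0. Qed.

Lemma ordL_uniformizer_exp n : ordL (uniformizer k ^ n) = n.
Proof.
have ordn (m : nat) : ordL (uniformizer k ^+ m) = m%:Z.
  elim: m => [|m IH]; first by rewrite ordL1.
  by rewrite exprS ordLM ?expf_neq0 ?uniformizer_neq0// IH ordL_monoL; lia.
case: n => n; first exact: ordn.
rewrite -[uniformizer k ^ _]/(uniformizer k ^- n.+1).
by rewrite NegzE ordLV ?expf_neq0 ?uniformizer_neq0// ordn.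
Qed.

Lemma vanish_below_uniformizer n : vanish_below (uniformizer k ^ n) n.
Proof.
by apply/vanish_below_ordL; rewrite ?uniformizer_exp_neq0// ordL_uniformizer_exp.
Qed.

End LaurentOrder.

Lemma forall_I2 (P : 'I_2 -> Prop) : P 0 -> P 1 -> forall i, P i.
Proof.
move=> P0 P1 i; case: (unliftP ord0 i) => [j ->|->//].
by rewrite (ord1 j) (_ : lift _ _ = 1) //; exact/val_inj.
Qed.

Lemma big_I2 (V : nmodType) (f : 'I_2 -> V) : \sum_i f i = f 0 + f 1.
Proof.
rewrite !big_ord_recl big_ord0 addr0; congr (_ + f _); exact/val_inj.
Qed.

Lemma det_I2 (A : comNzRingType) (M : 'M[A]_2) :
  \det M = M 0 0 * M 1 1 - M 0 1 * M 1 0.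
Proof.
have l01 : lift 1 0 = 0 :> 'I_2 by exact/val_inj.
have l00 : lift 0 0 = 1 :> 'I_2 by exact/val_inj.
rewrite (expand_det_row _ 0) big_I2 /cofactor !det_mx11 !mxE /= !(l01, l00).
by rewrite expr0 mul1r expr1 mulN1r mulrN.
Qed.

(** * Orders of matrices and of their rows *)

Section MatrixOrder.
Variable k : fieldType.
Local Notation F := (laurent k).
Implicit Types (a b n N : int) (c : F).

Definition mxge m p (n : int) (A : 'M[F]_(m, p)) :=
  forall i j, vanish_below (A i j) n.

Lemma mxgeW m p (A : 'M[F]_(m, p)) n n' : mxge n A -> n' <= n -> mxge n' A.
Proof. by move=> An n'n i j; exact: vanish_belowW (An i j) n'n. Qed.

Lemma mxgeM m p r (A : 'M[F]_(m, p)) (B : 'M[F]_(p, r)) a b :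
  mxge a A -> mxge b B -> mxge (a + b) (A *m B).
Proof.
by move=> Aa Bb i j; rewrite mxE; apply: vanish_below_sum => l _; exact: vanish_belowM.
Qed.

Lemma mxgeZ m p (A : 'M[F]_(m, p)) (c : F) a b :
  vanish_below c a -> mxge b A -> mxge (a + b) (c *: A).
Proof. by move=> ca Ab i j; rewrite mxE; exact: vanish_belowM. Qed.

Lemma mxge_expZ m p (A : 'M[F]_(m, p)) a b :
  mxge (a + b) ((uniformizer k) ^ a *: A) <-> mxge b A.
Proof.
split=> [AA|Ab]; last exact (mxgeZ (@vanish_below_uniformizer k a) Ab).
have := mxgeZ (@vanish_below_uniformizer k (- a)) AA.
by rewrite addKr scalerA -expfzDr ?uniformizer_neq0// addNr expr0z scale1r.
Qed.

Lemma mxgeD m p (A B : 'M[F]_(m, p)) n : mxge n A -> mxge n B -> mxge n (A + B).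
Proof. by move=> An Bn i j; rewrite mxE; exact: vanish_belowD. Qed.

Lemma mxge_det (A : 'M[F]_2) a b : mxge a (row 0 A) -> mxge b (row 1 A) ->
  vanish_below (\det A) (a + b).
Proof.
move=> Aa Ab; rewrite det_I2.
have A0 j : vanish_below (A 0 j) a by have := Aa 0 j; rewrite mxE.
have A1 j : vanish_below (A 1 j) b by have := Ab 0 j; rewrite mxE.
by apply: vanish_belowB; exact: vanish_belowM.
Qed.

Lemma mxge_row m p (A : 'M[F]_(m, p)) n i : mxge n A -> mxge n (row i A).
Proof. by move=> An i' j; rewrite mxE. Qed.

(** The inverse is the adjugate, whose entries are integral, divided by a unit of [O]. *)
Lemma mxge_invmx (A : 'M[F]_2) : A \in unitmx -> mxge 0 A ->
  ordL (\det A) = 0 -> mxge 0 (invmx A).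
Proof.
move=> Au A0 dA; rewrite /invmx Au; apply: (@mxgeZ _ _ _ _ 0 0).
  move: Au; rewrite unitmxE unitfE => dA0.
  by apply/vanish_below_ordL; rewrite ?invr_neq0// ordLV// dA.
move=> i j; rewrite mxE /cofactor det_mx11 !mxE; apply: (@vanish_belowM _ _ _ 0 0) => //.
rewrite -signr_odd; case: odd; rewrite ?expr0 ?expr1; last first.
  exact: (@vanish_below_uniformizer k 0).
exact/vanish_belowN/(@vanish_below_uniformizer k 0).
Qed.

(** Characterizing the order through all [n] at once avoids infinite orders for zero entries; the
    zero matrix gets the default 0. *)
Definition rowval m p (v : 'M[F]_(m, p)) : int :=
  xget 0 [set N | forall n, n <= N <-> mxge n v].

Lemma rowval_unique m p (v : 'M[F]_(m, p)) N :
  (forall n, n <= N <-> mxge n v) -> rowval v = N.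
Proof.
move=> vN; have vv : forall n, n <= rowval v <-> mxge n v.
  by apply: (@xgetPex _ 0 [set N | forall n, n <= N <-> mxge n v]); exists N.
apply/eqP; rewrite eq_le; apply/andP; split.
  by apply/vN/vv.
by apply/vv/vN.
Qed.

Lemma eq_rowval m p m' p' (v : 'M[F]_(m, p)) (w : 'M[F]_(m', p')) :
  (forall n, mxge n v <-> mxge n w) -> rowval v = rowval w.
Proof.
move=> vw; rewrite /rowval; congr xget; apply/seteqP.
by split=> N /= NP n; rewrite NP vw.
Qed.

Lemma mxge_row2 (v : 'rV[F]_2) n :
  mxge n v <-> vanish_below (v 0 0) n /\ vanish_below (v 0 1) n.
Proof.
split=> [vn|[v0 v1] i]; first by split.
by rewrite ord1; apply: forall_I2.
Qed.

Lemma rowval_l (v : 'rV[F]_2) : v 0 0 != 0 -> v 0 1 = 0 -> rowval v = ordL (v 0 0).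
Proof.
move=> v0 v1; apply: rowval_unique => n; rewrite mxge_row2 v1 -vanish_below_ordL//.
by split=> [?|[]//]; split=> //; exact: vanish_below0.
Qed.

Lemma rowval_r (v : 'rV[F]_2) : v 0 0 = 0 -> v 0 1 != 0 -> rowval v = ordL (v 0 1).
Proof.
move=> v0 v1; apply: rowval_unique => n; rewrite mxge_row2 v0 -vanish_below_ordL//.
by split=> [?|[]//]; split=> //; exact: vanish_below0.
Qed.

Lemma rowval_min (v : 'rV[F]_2) : v 0 0 != 0 -> v 0 1 != 0 ->
  rowval v = Num.min (ordL (v 0 0)) (ordL (v 0 1)).
Proof.
move=> v0 v1; apply: rowval_unique => n; rewrite mxge_row2 le_min.
by rewrite !vanish_below_ordL//; split => [/andP[]|[-> ->]].
Qed.

Lemma rowvalP (v : 'rV[F]_2) n : v != 0 -> n <= rowval v <-> mxge n v.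
Proof.
move=> v_neq0; suff [N vN] : exists N, forall n, n <= N <-> mxge n v.
  by rewrite (rowval_unique vN).
have E := mxge_row2 v.
have [v0|v0] := eqVneq (v 0 0) 0; have [v1|v1] := eqVneq (v 0 1) 0.
- case/eqP: v_neq0; apply/rowP; apply: forall_I2; by rewrite mxE.
- exists (ordL (v 0 1)) => m; rewrite E v0 -vanish_below_ordL//.
  by split=> [?|[]//]; split=> //; exact: vanish_below0.
- exists (ordL (v 0 0)) => m; rewrite E v1 -vanish_below_ordL//.
  by split=> [?|[]//]; split=> //; exact: vanish_below0.
- exists (Num.min (ordL (v 0 0)) (ordL (v 0 1))) => m; rewrite E le_min.
  by rewrite !vanish_below_ordL//; split => [/andP[]|[-> ->]].
Qed.

Lemma mxge_rowval (v : 'rV[F]_2) : v != 0 -> mxge (rowval v) v.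
Proof. by move=> v0; apply/rowvalP. Qed.

Lemma rowvalZ (v : 'rV[F]_2) (c : F) : v != 0 -> c != 0 ->
  rowval (c *: v) = ordL c + rowval v.
Proof.
move=> v0 c0; apply: rowval_unique => n; rewrite -lerBlDl rowvalP//.
have ci : vanish_below ((c^-1)%R : F) (- ordL c).
  by apply/vanish_below_ordL; rewrite ?invr_neq0// ordLV.
split=> [vn|/(mxgeZ ci)].
  by rewrite -[n](subrKC (ordL c)); apply: mxgeZ => //; case: (ordLP c0).
by rewrite scalerA mulVf// scale1r addrC.
Qed.

Lemma rowval_mul_GL2O (v : 'rV[F]_2) (U : 'M[F]_2) : U \in unitmx ->
  mxge 0 U -> mxge 0 (invmx U) -> rowval (v *m U) = rowval v.
Proof.
move=> Uu U0 iU0; apply: eq_rowval => n; split=> [vU|vn].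
  by rewrite -[v](mulmxK Uu) -[n]addr0; exact: mxgeM.
by rewrite -[n]addr0; exact: mxgeM.
Qed.

End MatrixOrder.

(** * Lattices and matrices *)

Lemma invmxM (R : comUnitRingType) n (A B : 'M[R]_n) :
  A \in unitmx -> B \in unitmx -> invmx (A *m B) = invmx B *m invmx A.
Proof.
move=> Au Bu; apply: (can_inj (mulmxK (_ : A *m B \in unitmx))).
  by rewrite unitmx_mul Au.
rewrite mulVmx ?unitmx_mul ?Au// mulmxA -(mulmxA _ _ A) mulVmx// mulmx1.
by rewrite mulVmx.
Qed.

Section VertexRep.
Variable k : fieldType.
Local Notation F := (laurent k).
Local Notation unif := (uniformizer k).
Implicit Types (h A M U : 'M[F]_2) (u w : vertex k) (L : set 'rV[F]_2).

(** The group [GL_2(O)]. *)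
Definition GL2O U := [/\ U \in unitmx, mxge 0 U & mxge 0 (invmx U)].

Lemma GL2O_ordL_det U : GL2O U -> ordL (\det U) = 0.
Proof.
move=> [Uu U0 iU0].
have dU : \det U != 0 by rewrite -unitfE -unitmxE.
have : (0 : int) <= ordL (\det U).
  by apply: ordL_ge => //; apply: (@mxge_det _ _ 0 0); exact: mxge_row.
have : (0 : int) <= ordL (\det (invmx U)).
  apply: ordL_ge; first by rewrite det_inv invr_neq0.
  by apply: (@mxge_det _ _ 0 0); exact: mxge_row.
by rewrite det_inv ordLV//; set z := ordL _; lia.
Qed.

Lemma GL2OV U : GL2O U -> GL2O (invmx U).
Proof. by move=> [Uu U0 iU0]; split; rewrite ?unitmx_inv ?invmxK. Qed.

(** The matrix [h *m invmx h'] holds the coordinates of the rows of [h] in the basis [h'], and these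
    rows come from the unit vectors, which are integral. *)
Lemma sub_lattice_of h h' : h' \in unitmx ->
  lattice_of h `<=` lattice_of h' <-> mxge 0 (h *m invmx h').
Proof.
move=> h'u; split=> [hh' i j|hh' _ [v v0 <-]].
  have [v v0 vh'] : lattice_of h' (delta_mx 0 i *m h).
    apply: hh'; exists (delta_mx 0 i) => // j'; rewrite mxE.
    by case: (_ && _); [exact: (@vanish_below_uniformizer k 0)|exact: vanish_below0].
  rewrite (_ : _ i j = v 0 j); first exact: v0.
  by rewrite -(mulmxK h'u v) vh' -mulmxA -rowE [RHS]mxE.
exists (v *m (h *m invmx h')); last by rewrite mulmxA mulmxKV.
by move=> j; apply: (@mxgeM _ _ _ _ v _ 0 0) => // i j'; rewrite ord1; exact: v0.
Qed.

Lemma lattice_of_eq h h' : h \in unitmx -> h' \in unitmx ->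
  lattice_of h = lattice_of h' <-> GL2O (h *m invmx h').
Proof.
move=> hu h'u; rewrite /GL2O unitmx_mul hu unitmx_inv h'u.
rewrite invmxM ?unitmx_inv// invmxK eqEsubset.
by split=> [[/(sub_lattice_of _ h'u) ? /(sub_lattice_of _ hu) ?]|
  [_ /(sub_lattice_of _ h'u) ? /(sub_lattice_of _ hu) ?]].
Qed.

Lemma scale_lattice_of (c : F) h : scale_lattice c (lattice_of h) = lattice_of (c *: h).
Proof.
rewrite /scale_lattice /lattice_of image_comp.
by apply: eq_imagel => v _ /=; rewrite scalemxAr.
Qed.

Lemma unitmxZ_field (c : F) h : c != 0 -> h \in unitmx -> c *: h \in unitmx.
Proof. by move=> c0 hu; rewrite unitmxZ ?unitfE. Qed.

(** Vertices are handled through bases of their lattices; such a basis is unique up to [F^*] and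
    [GL_2(O)], by [rep_change] and [repZU]. *)
Definition rep u h := h \in unitmx /\ vertex_class u (lattice_of h).

Lemma vertex_class_lattice u :
  exists2 h, h \in unitmx & vertex_class u = homothety_class (lattice_of h).
Proof. by have [L [h hu ->] ->] := vertex_classP u; exists h. Qed.

Lemma repE u h : rep u h -> vertex_class u = homothety_class (lattice_of h).
Proof.
have [h0 h0u uE] := vertex_class_lattice u.
rewrite /rep uE => -[hu [c c0 hh0]]; rewrite hh0; apply/seteqP; split=> L [d d0 ->].
  exists (d / c); first by rewrite mulf_neq0 ?invr_neq0.
  by rewrite !scale_lattice_of scalerA divfK.
by exists (d * c); [rewrite mulf_neq0 | rewrite !scale_lattice_of scalerA].
Qed.

Lemma rep_lattice u L : vertex_class u L -> exists2 h, rep u h & L = lattice_of h.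
Proof.
have [h0 h0u uE] := vertex_class_lattice u.
rewrite uE => -[c c0 ->]; exists (c *: h0); last by rewrite scale_lattice_of.
by split; rewrite ?unitmxZ_field// uE; exists c => //; rewrite scale_lattice_of.
Qed.

Lemma rep_exists u : exists h, rep u h.
Proof.
have [h hu uE] := vertex_class_lattice u; exists h; split=> //.
by rewrite uE; exists 1; rewrite ?oner_neq0// scale_lattice_of scale1r.
Qed.

Lemma rep_vertex_of h (hu : h \in unitmx) : rep (vertex_of hu) h.
Proof.
by split=> //; exists 1; rewrite ?oner_neq0// scale_lattice_of scale1r.
Qed.

Lemma rep_inj u w h : rep u h -> rep w h -> u = w.
Proof. by move=> /repE uh /repE wh; apply: vertex_eq; rewrite uh wh. Qed.

Lemma rep_change u h h' : rep u h -> rep u h' ->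
  exists c U, [/\ c != 0, GL2O U & h' = c *: (U *m h)].
Proof.
move=> uh [h'u]; rewrite (repE uh) => -[c c0]; have [hu _] := uh.
rewrite scale_lattice_of lattice_of_eq ?unitmxZ_field// invmxZ ?unitmxZ_field//.
set U := (X in GL2O X) => UO; exists c, U; split=> //.
by rewrite /U -scalemxAr -scalemxAl mulmxKV// scalerA mulfV// scale1r.
Qed.

Lemma repZU u h (c : F) U : c != 0 -> GL2O U -> rep u h -> rep u (c *: (U *m h)).
Proof.
move=> c0 UO uh; have [hu _] := uh; have [Uu _ _] := UO; split.
  by rewrite unitmxZ_field// unitmx_mul Uu.
rewrite (repE uh); exists c => //; rewrite scale_lattice_of.
apply/lattice_of_eq; rewrite ?unitmxZ_field ?unitmx_mul ?Uu//.
rewrite invmxZ ?unitmxZ_field// -scalemxAr -scalemxAl mulmxK// scalerA.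
by rewrite mulVf// scale1r.
Qed.

Lemma rep_act (g : GL2 k) u h : rep u h -> rep (act_vertex g u) (h *m invmx g).
Proof.
move=> [hu uh]; split; first by rewrite unitmx_mul hu unitmx_inv GL2_unit.
by exists (lattice_of h) => //; rewrite act_lattice_of.
Qed.

(** For the base change [A] between the two lattices, [A] and [pi A^-1] are integral and the orders
    of their determinants add up to 2. Strictness of each inclusion keeps the corresponding order
    from being 0, so both are 1. *)
Lemma adjacent_rep u w : adjacent u w -> exists h A,
  [/\ rep u h, rep w (A *m h), A \in unitmx /\ ordL (\det A) = 1, mxge 0 A &
     mxge 0 (unif *: invmx A)].
Proof.
move=> [_ [_ [/rep_lattice[h uh ->] /rep_lattice[h' wh' ->]]]].
have [hu _] := uh; have [h'u _] := wh'.
rewrite scale_lattice_of => -[pih nph] [h'h nh'h].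
have u0 := uniformizer_neq0 k.
have [A AE] : exists A, A = h' *m invmx h by exists (h' *m invmx h).
have Au : A \in unitmx by rewrite AE unitmx_mul h'u unitmx_inv.
have iA : invmx A = h *m invmx h' by rewrite AE invmxM ?unitmx_inv// invmxK.
have A0 : mxge 0 A by rewrite AE; apply/sub_lattice_of.
have B0 : mxge 0 (unif *: invmx A).
  by rewrite iA scalemxAl; apply/sub_lattice_of.
have Bu : unif *: invmx A \in unitmx by rewrite unitmxZ_field// unitmx_inv.
have iB : invmx (unif *: invmx A) = h' *m invmx (unif *: h).
  rewrite invmxZ// invmxK invmxZ; last exact: unitmxZ_field.
  by rewrite -scalemxAr AE.
have wA : rep w (A *m h) by rewrite AE mulmxKV.
exists h, A; split; [exact: uh|exact: wA| |exact: A0|exact: B0].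
split; first exact: Au.
have dA : \det A != 0 by rewrite -unitfE -unitmxE.
have dB : \det (unif *: invmx A) != 0 by rewrite -unitfE -unitmxE.
have dAB : ordL (\det (unif *: invmx A)) = 2 - ordL (\det A).
  rewrite detZ det_inv ordLM ?expf_neq0 ?invr_neq0// ordLV//.
  by rewrite -[unif ^+ 2]/(unif ^ 2) ordL_uniformizer_exp.
have dA_ge : (0 : int) <= ordL (\det A).
  by apply: ordL_ge => //; apply: (@mxge_det _ _ 0 0); exact: mxge_row.
have dB_ge : (0 : int) <= ordL (\det (unif *: invmx A)).
  by apply: ordL_ge => //; apply: (@mxge_det _ _ 0 0); exact: mxge_row.
have dA0 : ordL (\det A) <> 0.
  move=> dA0; apply: nh'h; apply/sub_lattice_of => //; rewrite -iA.
  exact: mxge_invmx.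
have dB0 : ordL (\det (unif *: invmx A)) <> 0.
  move=> dB0; apply: nph; apply/sub_lattice_of; rewrite ?unitmxZ_field//.
  by rewrite -iB; exact: mxge_invmx.
by move: dA0 dB0 dA_ge dB_ge; rewrite dAB; set z := ordL _; lia.
Qed.

Lemma adjacent_sym u w : adjacent u w -> adjacent w u.
Proof.
move=> [_ [_ [/rep_lattice[h uh ->] /rep_lattice[h' wh' ->] pih h'h]]].
have u0 := uniformizer_neq0 k; have [hu _] := uh.
exists (lattice_of h'), (lattice_of (unif *: h)); split.
- by case: wh'.
- by rewrite (repE uh); exists unif => //; rewrite scale_lattice_of.
- case: h'h => h'h nh'h; split; rewrite -scale_lattice_of.
    exact: image_subset.
  rewrite !scale_lattice_of => sub; apply: nh'h => v hv.
  have /sub[v' v'0 vv'] : lattice_of (unif *: h) (unif *: v).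
    by case: hv => t t0 <-; exists t; rewrite // -scalemxAr.
  exists v' => //; apply: (scalerI u0).
  by rewrite -vv' -scalemxAr.
- by rewrite scale_lattice_of in pih.
Qed.

End VertexRep.

(** * Defect and gap of a matrix *)

Section Defect.
Variable k : fieldType.
Local Notation F := (laurent k).
Local Notation unif := (uniformizer k).
Implicit Types (h A M U : 'M[F]_2) (u w : vertex k) (n : int).

Lemma row_unitmx_neq0 M i : M \in unitmx -> row i M != 0.
Proof.
move=> Mu; apply/eqP => Mi0.
have : delta_mx 0 i = 0 :> 'rV[F]_2 by rewrite -(mulmxK Mu (delta_mx 0 i)) -rowE Mi0 mul0mx.
by move=> /rowP/(_ i)/eqP; rewrite !mxE !eqxx oner_eq0.
Qed.

Definition defect M : int :=
  ordL (\det M) - rowval (row 0 M) - rowval (row 1 M).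

Definition gap M : int := rowval (row 1 M) - rowval (row 0 M).

Lemma det_unitmx_neq0 M : M \in unitmx -> \det M != 0.
Proof. by rewrite unitmxE unitfE. Qed.

Lemma defect_ge0 M : M \in unitmx -> 0 <= defect M.
Proof.
move=> Mu; rewrite /defect -addrA -opprD subr_ge0.
apply: ordL_ge; first exact: det_unitmx_neq0.
by apply: mxge_det; apply: mxge_rowval; exact: row_unitmx_neq0.
Qed.

Lemma rowval_change M (c : F) U i : M \in unitmx -> c != 0 -> GL2O U ->
  rowval (row i (c *: (M *m U))) = ordL c + rowval (row i M).
Proof.
move=> Mu c0 [Uu U0 iU0].
have -> : row i (c *: (M *m U)) = c *: (row i M *m U).
  by rewrite -row_mul; apply/rowP => j; rewrite !mxE.
rewrite rowvalZ// ?rowval_mul_GL2O//.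
by rewrite -row_mul row_unitmx_neq0// unitmx_mul Mu.
Qed.

Lemma ordL_det_change M (c : F) U : M \in unitmx -> c != 0 -> GL2O U ->
  ordL (\det (c *: (M *m U))) = ordL c + ordL c + ordL (\det M).
Proof.
move=> Mu c0 UO; have [Uu _ _] := UO.
rewrite detZ det_mulmx expr2 !ordLM ?mulf_neq0 ?det_unitmx_neq0//.
by rewrite (GL2O_ordL_det UO) addr0.
Qed.

Lemma defect_change M (c : F) U : M \in unitmx -> c != 0 -> GL2O U ->
  defect (c *: (M *m U)) = defect M.
Proof.
by move=> Mu c0 UO; rewrite /defect ordL_det_change// !rowval_change//; ring.
Qed.

Lemma gap_change M (c : F) U : M \in unitmx -> c != 0 -> GL2O U ->
  gap (c *: (M *m U)) = gap M.
Proof. by move=> Mu c0 UO; rewrite /gap !rowval_change//; ring. Qed.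

(* [A] takes a basis of a lattice [L] to one of a lattice [L'] with
   [pi L < L' < L]. *)
Definition elementary A :=
  [/\ A \in unitmx, ordL (\det A) = 1, mxge 0 A & mxge 0 (unif *: invmx A)].

Lemma mxge_elementary_inv A : elementary A -> mxge (-1) (invmx A).
Proof.
move=> [_ _ _ iA0]; apply/(mxge_expZ _ 1); rewrite expr1z subrr.
exact: iA0.
Qed.

Lemma rowval_elementary M A i : M \in unitmx -> elementary A ->
  rowval (row i M) - 1 <= rowval (row i (M *m invmx A)) <= rowval (row i M).
Proof.
move=> Mu eA; have [Au _ A0 _] := eA.
have NU : M *m invmx A \in unitmx by rewrite unitmx_mul Mu unitmx_inv.
have r0 := row_unitmx_neq0 i Mu; have r'0 := row_unitmx_neq0 i NU.
apply/andP; split; apply/rowvalP => //.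
  by rewrite row_mul; apply: mxgeM; [exact: mxge_rowval|exact: mxge_elementary_inv].
rewrite -{2}[M](mulmxKV Au) [in X in mxge _ X]row_mul -[X in mxge X]addr0.
by apply: mxgeM => //; exact: mxge_rowval.
Qed.

Lemma ordL_det_elementary M A : M \in unitmx -> elementary A ->
  ordL (\det (M *m invmx A)) = ordL (\det M) - 1.
Proof.
move=> Mu [Au dA _ _].
by rewrite det_mulmx det_inv ordLM ?ordLV ?invr_neq0 ?det_unitmx_neq0// dA.
Qed.

(** The order of the determinant drops by 1 and each row order by 0 or 1. If exactly one row order
    drops, only the gap changes; if none or both do, only the defect changes. *)
Lemma elementary_step M A : M \in unitmx -> elementary A ->
  let N := M *m invmx A in
  `|defect M - defect N| + `|gap M - gap N| = 1.
Proof.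
move=> Mu eA N; rewrite /defect /gap (ordL_det_elementary Mu eA).
have := rowval_elementary 0 Mu eA; have := rowval_elementary 1 Mu eA.
rewrite -/N; set r0 := rowval (row 0 M); set r1 := rowval (row 1 M).
set s0 := rowval (row 0 N); set s1 := rowval (row 1 N); set d := ordL _.
by lia.
Qed.

(** A column operation over [O] clears the entry of larger order in the first row by a multiple of
    the other one; the columns are swapped when the second entry has the smaller order. *)
Lemma triangularize M : M \in unitmx -> exists2 U, GL2O U & (M *m U) 0 1 = 0.
Proof.
move=> Mu; have r0 := row_unitmx_neq0 0 Mu.
have entry j : (row 0 M) 0 j = M 0 j by rewrite mxE.
have vb (x : F) y : y != 0 -> (x = 0 \/ ordL y <= ordL x) ->
    vanish_below ((- (x / y))%R : F) 0.
  move=> y0; have [-> _|x0 [/eqP|]] := eqVneq x 0.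
  - by rewrite mul0r oppr0; exact: vanish_below0.
  - by rewrite (negPf x0).
  by move=> yx; apply/vanish_belowN/vanish_below_ordL;
    rewrite ?mulf_neq0 ?invr_neq0// ordLM ?invr_neq0// ordLV// subr_ge0.
have one0 : vanish_below (1 : F) 0 by exact: (@vanish_below_uniformizer k 0).
have zero0 : vanish_below (0 : F) 0 by exact: vanish_below0.
have GLO U : ordL (\det U) = 0 -> \det U != 0 -> mxge 0 U -> GL2O U.
  move=> dU dU0 U0; have Uu : U \in unitmx by rewrite unitmxE unitfE.
  by split=> //; exact: mxge_invmx.
have [M00|M00] := boolP ((M 0 0 != 0) && ((M 0 1 == 0) || (ordL (M 0 0) <= ordL (M 0 1)))).
  move: M00 => /andP[M00 le01].
  pose t := - (M 0 1 / M 0 0).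
  pose U := \matrix_(i < 2, j < 2) (if i == 0 then if j == 0 then 1 else t
                else if j == 0 then 0 else 1 : F).
  have dU : \det U = 1 by rewrite det_I2 !mxE /= mulr1 mulr0 subr0.
  exists U; last by rewrite mxE big_I2 !mxE /= mulr1 /t mulrN mulrCA divff// mulr1 addNr.
  apply: GLO; rewrite ?dU ?ordL1 ?oner_neq0//.
  apply: forall_I2; apply: forall_I2; rewrite !mxE //=.
  by apply: vb => //; case/orP: le01 => [/eqP|]; [left|right].
have M01 : M 0 1 != 0.
  apply: contraNneq M00 => M01; rewrite M01 eqxx andbT.
  apply: contraNneq r0 => M00; apply/eqP/rowP; apply: forall_I2.
    by rewrite entry M00 mxE.
  by rewrite entry M01 mxE.
have le10 : M 0 0 = 0 \/ ordL (M 0 1) <= ordL (M 0 0).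
  move: M00; rewrite negb_and negbK (negPf M01) /= -ltNge.
  by move=> /orP[/eqP|/ltW]; [left|right].
pose t := - (M 0 0 / M 0 1).
pose U := \matrix_(i < 2, j < 2) (if i == 0 then if j == 0 then 0 else 1
              else if j == 0 then 1 else t : F).
have dU : \det U = - 1 by rewrite det_I2 !mxE /= mulr1 mul0r sub0r.
exists U; last by rewrite mxE big_I2 !mxE /= mulr1 /t mulrN mulrCA divff// mulr1 subrr.
apply: GLO; rewrite ?dU ?ordLN ?ordL1 ?oppr_eq0 ?oner_neq0//.
apply: forall_I2; apply: forall_I2; rewrite !mxE //=.
exact: vb.
Qed.

Section Triangular.
Variable T : 'M[F]_2.
Hypotheses (Tu : T \in unitmx) (T01 : T 0 1 = 0) (T_gt0 : 0 < defect T).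
Local Notation r := (rowval (row 0 T)).
Local Notation s := (rowval (row 1 T)).

Lemma triangular_diag_neq0 : T 0 0 != 0 /\ T 1 1 != 0.
Proof.
have := det_unitmx_neq0 Tu; rewrite det_I2 T01 mul0r subr0 mulf_eq0 negb_or.
by move=> /andP.
Qed.

Lemma triangular_rowval0 : r = ordL (T 0 0).
Proof.
have [T00 _] := triangular_diag_neq0.
by rewrite rowval_l !mxE.
Qed.

(** For triangular [T] the defect is [ord T_11 - s]. *)
Lemma triangular_ordL_lt : s < ordL (T 1 1).
Proof.
have [T00 T11] := triangular_diag_neq0.
move: T_gt0; rewrite /defect det_I2 T01 mul0r subr0 ordLM// triangular_rowval0.
by rewrite [_ + ordL _]addrC addrK subr_gt0.
Qed.

Lemma triangular_ordL10 : T 1 0 != 0 /\ ordL (T 1 0) = s.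
Proof.
have [T00 T11] := triangular_diag_neq0; have := triangular_ordL_lt.
have [T10|T10] := eqVneq (T 1 0) 0.
  by rewrite rowval_r !mxE// T10 ltxx.
rewrite rowval_min !mxE// => lt_s; split=> //.
apply/esym/min_idPl; rewrite leNgt; apply: contraTN lt_s => lt10.
by rewrite minEle leNgt lt10 /= ltxx.
Qed.

(* Modulo terms of higher order the two rows of [T] are proportional, so that
   multiplication by a matrix of order at least -1 lowers both or none. *)
Lemma triangular_flat (B : 'M[F]_2) : mxge (-1) B ->
  mxge r (row 0 T *m B) <-> mxge s (row 1 T *m B).
Proof.
move=> B1; have [T00 T11] := triangular_diag_neq0.
have [T10 T10s] := triangular_ordL10; have T11s := triangular_ordL_lt.
(* The part of row 1 not proportional to row 0. Its order exceeds [s], so [B] cannot bring it below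
   [s]. *)
pose d : 'rV[F]_2 := T 1 1 *: delta_mx 0 1.
have row1E : row 1 T = (T 1 0 / T 0 0) *: row 0 T + d.
  apply/rowP; apply: forall_I2; rewrite !mxE /=.
    by rewrite divfK// mulr0 addr0.
  by rewrite T01 mulr0 add0r mulr1.
have dB : mxge s (d *m B).
  rewrite -[s](addrK 1); apply: mxgeM => //.
  have [d0 d1] : d 0 0 = 0 /\ d 0 1 = T 1 1 by rewrite !mxE /= mulr0 mulr1.
  apply/mxge_row2; rewrite d0 d1; split; first exact: vanish_below0.
  by apply/vanish_below_ordL => //; rewrite lezD1.
have row0E : row 0 T = (T 0 0 / T 1 0) *: (row 1 T + (- 1) *: d).
  have cc : T 0 0 / T 1 0 * (T 1 0 / T 0 0) = 1 by rewrite mulrA divfK// divff.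
  by rewrite row1E scaleN1r addrK scalerA cc scale1r.
split=> [rT|sT].
  rewrite [in X in mxge _ X]row1E mulmxDl -scalemxAl; apply: mxgeD => //.
  apply: (@mxgeW _ _ _ _ (s - r + r)); last by rewrite subrK.
  apply: mxgeZ => //; apply/vanish_below_ordL.
    by rewrite mulf_neq0 ?invr_neq0.
  by rewrite ordLM ?invr_neq0// ordLV// T10s triangular_rowval0.
rewrite [in X in mxge _ X]row0E -scalemxAl mulmxDl -scalemxAl.
apply: (@mxgeW _ _ _ _ (r - s + s)); last by rewrite subrK.
apply: mxgeZ.
  apply/vanish_below_ordL; first by rewrite mulf_neq0 ?invr_neq0.
  by rewrite ordLM ?invr_neq0// ordLV// T10s triangular_rowval0.
apply: mxgeD => //; rewrite -[s]add0r; apply: mxgeZ => //.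
exact/vanish_belowN/(@vanish_below_uniformizer k 0).
Qed.

End Triangular.

(** An unchanged defect means that exactly one row order drops. After triangularization,
    [triangular_flat] rules this out when the defect is positive. *)
Lemma elementary_flat M A : M \in unitmx -> elementary A ->
  defect M = defect (M *m invmx A) -> defect M = 0.
Proof.
move=> Mu eA MN; apply: contrapT => M0; have [Au _ _ _] := eA.
have [U UO MU] := triangularize Mu; have [Uu U0 iU0] := UO.
have Tu : M *m U \in unitmx by rewrite unitmx_mul Mu.
have T0 : defect (M *m U) = defect M.
  by rewrite -[M *m U]scale1r defect_change// oner_neq0.
have Tgt0 : 0 < defect (M *m U) by rewrite T0 lt_def defect_ge0// andbT; apply/eqP.
(* Since [(M U)(U^-1 A^-1) = M A^-1], this is the multiplier seen by the triangular matrix. *)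
have B1 : mxge (-1) (invmx U *m invmx A).
  by rewrite -[-1]add0r; apply: mxgeM => //; exact: mxge_elementary_inv.
have := triangular_flat Tu MU Tgt0 B1.
have rT i : rowval (row i (M *m U)) = rowval (row i M).
  by rewrite -[M *m U]scale1r rowval_change// ?oner_neq0// ordL1 add0r.
rewrite -!row_mul -!mulmxA !(mulmxA U) mulmxV// mul1mx !rT.
have Nu : M *m invmx A \in unitmx by rewrite unitmx_mul Mu unitmx_inv.
rewrite -!rowvalP ?row_unitmx_neq0//.
have := rowval_elementary 0 Mu eA; have := rowval_elementary 1 Mu eA.
move: MN; rewrite /defect (ordL_det_elementary Mu eA).
set r0 := rowval (row 0 M); set r1 := rowval (row 1 M).
set s0 := rowval (row 0 _); set s1 := rowval (row 1 _); set d := ordL _.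
by lia.
Qed.

End Defect.

(** * Defect and gap of a vertex *)

Section Apartment.
Variable k : fieldType.
Local Notation F := (laurent k).
Local Notation unif := (uniformizer k).
Implicit Types (h A M U : 'M[F]_2) (u w : vertex k) (n : int).

Lemma invmx_eq (M N : 'M[F]_2) : M *m N = 1%:M -> invmx M = N.
Proof.
by move=> MN; have [Mu _] := mulmx1_unit MN; rewrite -[N](mulKmx Mu) MN mulmx1.
Qed.

Lemma mul_std_mx n M i j :
  (std_mx k n *m M) i j = (if i == 0 then unif ^ n else 1) * M i j.
Proof. by rewrite mul_diag_mx !mxE. Qed.

Lemma mul_mx_std n M i j :
  (M *m std_mx k n) i j = M i j * (if j == 0 then unif ^ n else 1).
Proof. by rewrite mul_mx_diag !mxE. Qed.

Lemma std_mxE n i j :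
  std_mx k n i j = if i == j then if i == 0 then unif ^ n else 1 else 0.
Proof.
by rewrite !mxE; case: (i == j); rewrite ?mulr1n ?mulr0n.
Qed.

Lemma std_mxD m n : std_mx k m *m std_mx k n = std_mx k (m + n).
Proof.
apply/matrixP => i j; rewrite mul_std_mx !std_mxE.
case: (i == j); last by rewrite mulr0.
by case: (i == 0); rewrite ?mulr1// expfzDr ?uniformizer_neq0.
Qed.

Lemma std_mx0 : std_mx k 0 = 1%:M.
Proof.
by apply/matrixP => i j; rewrite std_mxE mxE; case: (i == j) => //; case: (i == 0).
Qed.

Lemma invmx_std_mx n : invmx (std_mx k n) = std_mx k (- n).
Proof. by apply: invmx_eq; rewrite std_mxD subrr std_mx0. Qed.

Lemma det_std_mx n : \det (std_mx k n) = unif ^ n.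
Proof. by rewrite det_I2 !std_mxE /= mulr1 mulr0 subr0. Qed.

Lemma rep_std_vertex n : rep (std_vertex k n) (std_mx k n).
Proof. exact: rep_vertex_of. Qed.

(** An equality instead of a strict inclusion would put [A] or [pi A^-1] in [GL_2(O)], while their
    determinants have order 1. *)
Lemma elementary_adjacent u w h A :
  rep u h -> rep w (A *m h) -> elementary A -> adjacent u w.
Proof.
move=> uh wAh [Au dA A0 iA0]; have [hu _] := uh; have [Ahu _] := wAh.
have u0 := uniformizer_neq0 k.
exists (lattice_of h), (lattice_of (A *m h)); split.
- by case: uh.
- by case: wAh.
- rewrite scale_lattice_of; have piE : unif *: h *m invmx (A *m h) = unif *: invmx A.
    by rewrite invmxM// -scalemxAl mulmxA mulmxV// mul1mx.
  split; first by apply/sub_lattice_of => //; rewrite piE.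
  move=> sub; have : lattice_of (A *m h) = lattice_of (unif *: h).
    by apply/seteqP; split => //; apply/sub_lattice_of => //; rewrite piE.
  move=> /(lattice_of_eq Ahu (unitmxZ_field u0 hu)) /GL2OV /GL2O_ordL_det.
  rewrite invmxM ?unitmx_inv ?unitmxZ_field// invmxK piE detZ det_inv.
  rewrite ordLM ?expf_neq0 ?invr_neq0 ?det_unitmx_neq0// ordLV ?det_unitmx_neq0// dA.
  by rewrite -[unif ^+ 2]/(unif ^ 2) ordL_uniformizer_exp.
- split; first by apply/sub_lattice_of => //; rewrite mulmxK.
  move=> /(sub_lattice_of _ Ahu); rewrite invmxM// mulmxA mulmxV// mul1mx => iA.
  have /GL2O_ordL_det : GL2O A by split.
  by rewrite dA.
Qed.

Lemma mxge_diag (A : 'M[F]_2) (x y : F) n :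
  (forall i j, A i j = if i == j then if i == 0 then x else y else 0) ->
  vanish_below x n -> vanish_below y n -> mxge n A.
Proof.
move=> AE xn yn i j; rewrite AE; case: (i == j); last exact: vanish_below0.
by case: (i == 0).
Qed.

Lemma vanish_below_unif n : 0 <= n -> vanish_below (unif ^ n) 0.
Proof. by apply: vanish_belowW; exact: vanish_below_uniformizer. Qed.

Lemma elementary_std_mx1 : elementary (std_mx k 1).
Proof.
split; rewrite ?std_mx_unit ?det_std_mx ?ordL_uniformizer_exp//.
  by apply: (mxge_diag (std_mxE 1)); last exact: (@vanish_below_unif 0);
    exact: vanish_below_unif.
rewrite invmx_std_mx; apply: (@mxge_diag _ (unif ^ 0) (unif ^ 1));
  try exact: vanish_below_unif.
move=> i j; rewrite mxE std_mxE; case: (i == j); last by rewrite mulr0.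
case: (i == 0); last by rewrite mulr1.
by rewrite expr0z mulfV// uniformizer_neq0.
Qed.
Lemma adjacent_std_vertex n : adjacent (std_vertex k n) (std_vertex k (n + 1)).
Proof.
rewrite addrC; apply: elementary_adjacent (rep_std_vertex n) _ elementary_std_mx1.
by rewrite std_mxD; exact: rep_std_vertex.
Qed.

Variable E : 'M[F]_2.
Hypothesis Eu : E \in unitmx.

Definition vertex_mx u : 'M[F]_2 := sval (cid (rep_exists u)).

Lemma rep_vertex_mx u : rep u (vertex_mx u).
Proof. exact: svalP. Qed.

(** The matrix holds the coordinates of the rows of [E] in a basis of a lattice of [u]; by
    [vdefectE] the choice of this basis does not matter. *)
Definition vdefect u := defect (E *m invmx (vertex_mx u)).
Definition vgap u := gap (E *m invmx (vertex_mx u)).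

Lemma coord_unitmx u h : rep u h -> E *m invmx h \in unitmx.
Proof. by case=> hu _; rewrite unitmx_mul Eu unitmx_inv. Qed.

Lemma coord_change u h : rep u h -> exists c U, [/\ c != 0, GL2O U &
  E *m invmx h = c *: (E *m invmx (vertex_mx u) *m U)].
Proof.
have uh0 := rep_vertex_mx u; have [h0u _] := uh0.
move=> /(rep_change uh0)[c [U [c0 UO hE]]]; have [Uu _ _] := UO.
exists c^-1, (invmx U); split; rewrite ?invr_neq0//; first exact: GL2OV.
rewrite hE invmxZ ?unitmxZ_field ?unitmx_mul ?Uu// invmxM//.
by rewrite -scalemxAr mulmxA.
Qed.

Lemma vdefectE u h : rep u h -> vdefect u = defect (E *m invmx h).
Proof.
move=> uh; have [c [U [c0 UO ->]]] := coord_change uh.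
by rewrite defect_change//; exact: coord_unitmx (rep_vertex_mx u).
Qed.

Lemma vgapE u h : rep u h -> vgap u = gap (E *m invmx h).
Proof.
move=> uh; have [c [U [c0 UO ->]]] := coord_change uh.
by rewrite gap_change//; exact: coord_unitmx (rep_vertex_mx u).
Qed.

Lemma vdefect_ge0 u : 0 <= vdefect u.
Proof. exact/defect_ge0/coord_unitmx/rep_vertex_mx. Qed.

Lemma adjacent_coord u w : adjacent u w -> exists M A, [/\ M \in unitmx,
  elementary A, vdefect u = defect M /\ vgap u = gap M &
  vdefect w = defect (M *m invmx A) /\ vgap w = gap (M *m invmx A)].
Proof.
move=> /adjacent_rep[h [A [uh wAh [Au dA] A0 iA0]]]; have [hu _] := uh.
exists (E *m invmx h), A; rewrite (vdefectE uh) (vgapE uh).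
rewrite (vdefectE wAh) (vgapE wAh) invmxM// mulmxA.
by split=> //; exact: coord_unitmx uh.
Qed.

Lemma adjacent_step u w : adjacent u w ->
  `|vdefect u - vdefect w| + `|vgap u - vgap w| = 1.
Proof.
by move=> /adjacent_coord[M [A [Mu eA [-> ->] [-> ->]]]]; exact: elementary_step.
Qed.

Lemma adjacent_flat u w : adjacent u w -> vdefect u = vdefect w -> vdefect u = 0.
Proof.
by move=> /adjacent_coord[M [A [Mu eA [-> _] [-> _]]]]; exact: elementary_flat.
Qed.

(** In a basis making the coordinate matrix [T] lower triangular, dividing the second column by [pi]
    lowers the order of the determinant by 1. It keeps both row orders, since [T 1 1] has order
    above that of its row. *)
Lemma vdefect_descent u : 0 < vdefect u ->
  exists2 w, adjacent u w & vdefect w = vdefect u - 1.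
Proof.
have uh0 := rep_vertex_mx u; have [h0u _] := uh0.
have [U UO] := triangularize (coord_unitmx uh0); have [Uu _ _] := UO.
have [h hE] : exists h, h = invmx U *m vertex_mx u by exists (invmx U *m vertex_mx u).
have uh : rep u h.
  rewrite hE -[X in rep _ X]scale1r.
  by apply: repZU; rewrite ?oner_neq0//; exact: GL2OV.
have [hu _] := uh.
have <- : E *m invmx h = E *m invmx (vertex_mx u) *m U.
  by rewrite hE invmxM ?unitmx_inv// invmxK mulmxA.
have [T TE] : exists T, T = E *m invmx h by exists (E *m invmx h).
rewrite (vdefectE uh); have := coord_unitmx uh; rewrite -TE => Tu T01 T_gt0.
have [T00 T11] := triangular_diag_neq0 Tu T01.
(* [A] is the diagonal matrix with entries [1, pi]. *)
have [A AE] : exists A : 'M[F]_2, A = unif *: std_mx k (-1).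
  by exists (unif *: std_mx k (-1)).
have u0 := uniformizer_neq0 k.
have Au : A \in unitmx by rewrite AE; apply: unitmxZ_field; rewrite ?std_mx_unit.
have iA : invmx A = unif^-1 *: std_mx k 1.
  by rewrite AE invmxZ -?AE// invmx_std_mx opprK.
have eA : elementary A.
  split; first exact: Au.
  - rewrite AE detZ det_std_mx -[unif ^+ 2]/(unif ^ 2) -expfzDr//.
    by rewrite ordL_uniformizer_exp.
  - apply: (@mxge_diag _ (unif ^ 0) (unif ^ 1));
  try exact: vanish_below_unif.
    move=> i j; rewrite AE mxE std_mxE; case: (i == j); last by rewrite mulr0.
    case: (i == 0); last by rewrite mulr1.
    by rewrite expr0z mulfV.
  - rewrite iA scalerA mulfV// scale1r.
    by apply: (mxge_diag (std_mxE 1)); last exact: (@vanish_below_unif 0);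
    exact: vanish_below_unif.
have wu : A *m h \in unitmx by rewrite unitmx_mul Au.
exists (vertex_of wu); first exact: elementary_adjacent uh (rep_vertex_of wu) eA.
rewrite (vdefectE (rep_vertex_of wu)) invmxM// mulmxA -TE.
have Nu : T *m invmx A \in unitmx by rewrite unitmx_mul Tu unitmx_inv.
have N0 i : (T *m invmx A) i 0 = T i 0.
  by rewrite iA -scalemxAr mxE mul_mx_std eqxx expr1z mulrCA mulVf// mulr1.
have N1 i : (T *m invmx A) i 1 = T i 1 / unif.
  by rewrite iA -scalemxAr mxE mul_mx_std [_ == _]/= mulr1 mulrC.
have Tge i : vanish_below (T i 0) (rowval (row i T)).
  by have /mxge_row2[] := mxge_rowval (row_unitmx_neq0 i Tu); rewrite mxE.
have r0 : mxge (rowval (row 0 T)) (row 0 (T *m invmx A)).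
  apply/mxge_row2; rewrite mxE N0 mxE N1 T01 mul0r.
  by split=> //; exact: vanish_below0.
have r1 : mxge (rowval (row 1 T)) (row 1 (T *m invmx A)).
  apply/mxge_row2; rewrite mxE N0 mxE N1; split=> //.
  apply/vanish_below_ordL; first by rewrite mulf_neq0 ?invr_neq0.
  rewrite ordLM ?invr_neq0// ordLV// (ordL_uniformizer_exp k 1).
  by rewrite -ltzD1 subrK; exact: triangular_ordL_lt.
have := rowval_elementary 0 Tu eA; have := rowval_elementary 1 Tu eA.
move: r0 r1; rewrite -!rowvalP ?row_unitmx_neq0//.
rewrite /defect (ordL_det_elementary Tu eA).
set a0 := rowval (row 0 T); set a1 := rowval (row 1 T).
set s0 := rowval (row 0 _); set s1 := rowval (row 1 _); set d := ordL _.
by clearbody a0 a1 s0 s1 d; clear; lia.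
Qed.

Definition E_inv : GL2 k := MkGL2 (etrans (unitmx_inv E) Eu).

(** The apartment of the two lines spanned by the rows [e_0, e_1] of [E]: [line n] is the class of
    [pi^n O e_0 + O e_1]. *)
Definition line n : vertex k := act_vertex E_inv (std_vertex k n).

Lemma rep_line n : rep (line n) (std_mx k n *m E).
Proof. by have := rep_act E_inv (rep_std_vertex n); rewrite /= invmxK. Qed.

Lemma vdefect_gap_line n : vdefect (line n) = 0 /\ vgap (line n) = n.
Proof.
rewrite (vdefectE (rep_line n)) (vgapE (rep_line n)).
rewrite invmxM ?std_mx_unit// mulKVmx// invmx_std_mx /defect /gap.
rewrite det_std_mx ordL_uniformizer_exp.
have -> : rowval (row 0 (std_mx k (- n))) = - n.
  by rewrite rowval_l !mxE//= ?mulr1n ?mulr0n ?ordL_uniformizer_exp ?uniformizer_exp_neq0.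
have -> : rowval (row 1 (std_mx k (- n))) = 0.
  by rewrite rowval_r !mxE//= ?mulr1n ?mulr0n ?ordL1 ?oner_neq0.
by split; ring.
Qed.

Lemma vdefect_line n : vdefect (line n) = 0.
Proof. by case: (vdefect_gap_line n). Qed.

Lemma vgap_line n : vgap (line n) = n.
Proof. by case: (vdefect_gap_line n). Qed.

(** Scaling each row of [M] to order 0 gives an integral matrix whose determinant has order
    [defect M], here 0. It lies in [GL_2(O)], so [h] and [std_mx k (gap M) *m E] span homothetic
    lattices. *)
Lemma vdefect0_line u : vdefect u = 0 -> u = line (vgap u).
Proof.
have uh := rep_vertex_mx u; have [hu _] := uh.
rewrite /vdefect /vgap; move: (vertex_mx u) uh hu => h uh hu.
have := coord_unitmx uh.
have [M ME] : exists M, M = E *m invmx h by exists (E *m invmx h).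
rewrite -ME => Mu.
set r0 := rowval (row 0 M); set r1 := rowval (row 1 M).
move=> M0; have [U UE] : exists U, U = unif ^ (- r1) *: (std_mx k (gap M) *m M).
  by exists (unif ^ (- r1) *: (std_mx k (gap M) *m M)).
have p0 := uniformizer_exp_neq0 k.
have ge_row i j : vanish_below (M i j) (rowval (row i M)).
  by have := mxge_rowval (row_unitmx_neq0 i Mu) 0 j; rewrite mxE.
have SM : mxge r1 (std_mx k (gap M) *m M).
  apply: forall_I2 => j; rewrite mul_std_mx.
    rewrite eqxx.
    apply: vanish_belowW
      (vanish_belowM (@vanish_below_uniformizer k _) (ge_row 0 j)) _.
    by rewrite /gap -/r0 -/r1 subrK.
  by rewrite [1 == 0]/= mul1r; exact: ge_row.
have U0 : mxge 0 U.
  by rewrite UE -(addNr r1); apply/mxge_expZ.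
have Uu : U \in unitmx by rewrite UE unitmxZ_field ?p0// unitmx_mul Mu std_mx_unit.
have UO : GL2O U.
  split=> //; apply: mxge_invmx => //.
  rewrite UE detZ det_mulmx det_std_mx expr2 !ordLM ?mulf_neq0 ?det_unitmx_neq0//.
  rewrite !ordL_uniformizer_exp; move: M0; rewrite /defect /gap -/r0 -/r1.
  set d := ordL _; clearbody d r0 r1; clear; lia.
have hE : h = unif ^ (- r1) *: (invmx U *m (std_mx k (gap M) *m E)).
  have -> : E = M *m h by rewrite ME mulmxKV.
  by rewrite mulmxA scalemxAr scalemxAl -UE mulKmx.
apply: rep_inj uh _; rewrite hE.
by apply: repZU; [exact: p0|exact: GL2OV|exact: rep_line].
Qed.

Lemma adjacent_line n : adjacent (line n) (line (n + 1)).
Proof. exact/act_adjacent/adjacent_std_vertex. Qed.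

End Apartment.

(** * The path metric *)

Section Realization.
Variables (R : realType) (k : fieldType).
Local Notation vertex := (vertex k).
Local Notation treeR := (treeR R k).
Implicit Types (u v w : vertex) (p : treeR) (s t l : R) (phi : vertex -> R).

Lemma adjacent_neq u w : adjacent u w -> u <> w.
Proof.
move=> /[swap] <- /(adjacent_step (unitmx1 _ 2)).
by set a := vdefect _ _; set b := vgap _ _; clearbody a b; clear; lia.
Qed.

Lemma edge_coordC u w t : edge_coord u w t = edge_coord w u (1 - t).
Proof. by apply/funext => v; rewrite /edge_coord subKr addrC. Qed.

Lemma on_edgeC u w t p : on_edge u w t p -> on_edge w u (1 - t) p.
Proof.
move=> [uw /andP[t0 t1] pE]; split; [exact: adjacent_sym| |].
  by rewrite subr_ge0 t1 lerBlDr lerDl.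
by rewrite pE edge_coordC.
Qed.

Lemma edge_coord0 u w : edge_coord u w 0 = fun v => `[< v = u >]%:R :> R.
Proof. by apply/funext => v; rewrite /edge_coord subr0 mul1r mul0r addr0. Qed.

Lemma edge_coord1 u w : edge_coord u w 1 = fun v => `[< v = w >]%:R :> R.
Proof. by rewrite edge_coordC subrr edge_coord0. Qed.

(** A point lies on an edge in two orientations, and a vertex on several edges. Comparing
    coordinates at the four endpoints, case by case on their coincidences, shows that the
    interpolated value is the same. *)
Lemma edge_coord_linext phi u w s u' w' t : u <> w -> u' <> w' ->
  edge_coord u w s = edge_coord u' w' t ->
  (1 - s) * phi u + s * phi w = (1 - t) * phi u' + t * phi w'.
Proof.
move=> uw u'w' /(congr1 (fun f => (f u, f w, f u', f w'))).
rewrite /edge_coord => -[].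
have asboolT (P : Prop) : P -> `[< P >] = true by move/asboolT.
have asboolF (P : Prop) : ~ P -> `[< P >] = false by move/asboolF.
rewrite !(asboolT (_ = _) erefl) (asboolF _ uw) (asboolF _ u'w').
rewrite (asboolF _ (fun e => uw (esym e))) (asboolF _ (fun e => u'w' (esym e))).
have [uu'|uu'] := pselect (u = u').
  subst u'; rewrite !(asboolT (u = u) erefl) (asboolF _ u'w') (asboolF _ uw).
  rewrite (asboolF _ (fun e => uw (esym e))) (asboolF _ (fun e => u'w' (esym e))).
  have [ww'|ww'] := pselect (w = w').
    by subst w'; rewrite !(asboolT (w = w) erefl) /=; nra.
  rewrite (asboolF _ ww') (asboolF _ (fun e => ww' (esym e))) /= => *.
  have -> : s = 0 by lra.
  have -> : t = 0 by lra.
  by lra.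
rewrite (asboolF _ uu') (asboolF _ (fun e => uu' (esym e))).
have [uw'|uw'] := pselect (u = w').
  subst w'; rewrite !(asboolT (u = u) erefl) (asboolF _ uw).
  rewrite (asboolF _ (fun e => uw (esym e))).
  have [wu'|wu'] := pselect (w = u').
    subst u'; rewrite !(asboolT (w = w) erefl) /= => *.
    have -> : s = 1 - t by lra.
    by lra.
  rewrite (asboolF _ wu') (asboolF _ (fun e => wu' (esym e))) /= => *.
  have -> : s = 0 by lra.
  have -> : t = 1 by lra.
  by lra.
rewrite (asboolF _ uw') (asboolF _ (fun e => uw' (esym e))) /= => s1 wE u'E w'E.
have s_1 : s = 1 by lra.
have [wu'|wu'] := pselect (w = u').
  subst u'; move: wE u'E; rewrite !(asboolT (w = w) erefl) (asboolF _ u'w') /= => *.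
  have -> : t = 0 by lra.
  by rewrite s_1; lra.
move: wE u'E w'E; rewrite (asboolF _ wu') (asboolF _ (fun e => wu' (esym e))) /=.
have [ww'|ww'] := pselect (w = w').
  subst w'; rewrite !(asboolT (w = w) erefl) /= => *.
  have -> : t = 1 by lra.
  by rewrite s_1; lra.
by rewrite (asboolF _ ww') (asboolF _ (fun e => ww' (esym e))) /=; lra.
Qed.

Lemma on_edge_exists p : exists e : vertex * vertex * R, on_edge e.1.1 e.1.2 e.2 p.
Proof. by have [u [w [t [uw t01 pE]]]] := baryP p; exists (u, w, t). Qed.

(** The extension of [phi] to [T(R)] that is affine on edges; by [linextE] the chosen edge is
    immaterial. *)
Definition linext phi p : R :=
  let: (u, w, t) := sval (cid (on_edge_exists p)) in (1 - t) * phi u + t * phi w.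

Lemma linextE phi u w t p : on_edge u w t p ->
  linext phi p = (1 - t) * phi u + t * phi w.
Proof.
move=> [uw t01 pE]; rewrite /linext.
case: cid => -[[u' w'] t'] /= [uw' _ pE'].
by apply: edge_coord_linext; [exact: adjacent_neq|exact: adjacent_neq|rewrite -pE -pE'].
Qed.

Lemma on_edge_ex u w t : adjacent u w -> 0 <= t <= 1 -> exists p, on_edge u w t p.
Proof.
move=> uw t01; have H : exists u' w' t', [/\ adjacent u' w', 0 <= t' <= 1 &
    edge_coord u w t = edge_coord u' w' t'] by exists u, w, t.
by exists (MkTreeR H).
Qed.

Lemma polygonal_path_ge0 p p' l : polygonal_path p p' l -> 0 <= l.
Proof. by elim=> [//|u w s t q q' q'' l' _ _ _ IH]; rewrite addr_ge0. Qed.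

Lemma polygonal_path_trans p p' p'' l l' :
  polygonal_path p p' l -> polygonal_path p' p'' l' -> polygonal_path p p'' (l + l').
Proof.
move=> pp'; elim: pp' p'' l' => [q q' l'|u w s t q q' q'' l1 qs qt _ IH r l' rl'].
  by rewrite add0r.
by rewrite -addrA; apply: polygonal_cons qs qt (IH _ _ rl').
Qed.

Lemma polygonal_path_segment u w s t p p' :
  on_edge u w s p -> on_edge u w t p' -> polygonal_path p p' `|s - t|.
Proof.
by move=> ps pt; rewrite -[X in polygonal_path _ _ X]addr0;
  apply: polygonal_cons ps pt (polygonal_nil _).
Qed.

Lemma polygonal_path_sym p p' l : polygonal_path p p' l -> polygonal_path p' p l.
Proof.
elim=> [q|u w s t q q' q'' l' qs qt _ IH]; first exact: polygonal_nil.
rewrite addrC distrC; apply: polygonal_path_trans IH _.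
exact: polygonal_path_segment qt qs.
Qed.

Definition lipschitz1 phi := forall u w, adjacent u w -> `|phi u - phi w| <= 1.

Lemma polygonal_path_lipschitz phi p p' l : lipschitz1 phi ->
  polygonal_path p p' l -> `|linext phi p - linext phi p'| <= l.
Proof.
move=> phi1; elim=> [q|u w s t q q' q'' l' qs qt _ IH]; first by rewrite subrr normr0.
rewrite -[linext phi q](subrK (linext phi q')) -addrA.
apply: le_trans (ler_normD _ _) _; apply: lerD IH.
rewrite (linextE phi qs) (linextE phi qt); have [uw _ _] := qs.
rewrite (_ : _ - _ = (t - s) * (phi u - phi w)); last by ring.
by rewrite normrM distrC ler_piMr// phi1.
Qed.

Lemma tree_dist_le p p' l : polygonal_path p p' l -> tree_dist p p' <= l.
Proof.
move=> pp'; apply: ge_inf => //.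
by exists 0 => l' pl'; exact: polygonal_path_ge0 pl'.
Qed.

(** The source of the lower bounds on distances. The given path makes the set of lengths nonempty;
    the infimum of the empty set would be 0. *)
Lemma tree_dist_ge phi p p' l : lipschitz1 phi -> polygonal_path p p' l ->
  `|linext phi p - linext phi p'| <= tree_dist p p'.
Proof.
move=> phi1 pp'; apply: lb_le_inf; first by exists l.
by move=> l' pl'; exact: polygonal_path_lipschitz pl'.
Qed.

(** * Paths along a line of vertices *)

Section Line.
Variable u : int -> vertex.
Hypothesis u_adj : forall n, adjacent (u n) (u (n + 1)).

Definition on_line p := exists n t, on_edge (u n) (u (n + 1)) t p.

Lemma on_edge_next n p :
  on_edge (u n) (u (n + 1)) 1 p <-> on_edge (u (n + 1)) (u (n + 1 + 1)) 0 p.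
Proof.
rewrite /on_edge edge_coord1 edge_coord0.
by split=> -[? ? ?]; split; rewrite ?lexx ?ler01.
Qed.

Lemma polygonal_line_nat n (d : nat) s t p p' :
  on_edge (u n) (u (n + 1)) s p -> on_edge (u (n + d%:Z)) (u (n + d%:Z + 1)) t p' ->
  polygonal_path p p' `|(n%:~R + s) - ((n + d%:Z)%:~R + t)|.
Proof.
elim: d n s p => [|d IH] n s p ps pt.
  have n0 : n + 0%N%:Z = n by exact: addr0.
  rewrite n0 in pt *.
  rewrite (_ : _ - _ = s - t); last by ring.
  exact: polygonal_path_segment ps pt.
(* The path passes through [u (n + 1)], the point of parameter 1 on this edge and 0 on the next. *)
have [q q1] := on_edge_ex (u_adj n) (introT andP (conj ler01 (lexx 1))).
have q0 := (on_edge_next n q).1 q1.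
have nd : n + d.+1%:Z = n + 1 + d%:Z by lia.
rewrite nd in pt *.
have := polygonal_path_trans (polygonal_path_segment ps q1) (IH _ _ _ q0 pt).
have [_ /andP[s0 s1] _] := ps; have [_ /andP[t0 t1] _] := pt.
set A := `|s - 1|; set B := `|_ - _|; set C := `|_ - _|.
suff -> : C = A + B by [].
rewrite /A /B /C !intrD; have : (0 : R) <= d%:Z%:~R by rewrite ler0z.
move: (d%:Z%:~R : R) (n%:~R : R) => x y x0.
by rewrite !ler0_norm; lra.
Qed.

Lemma polygonal_line m n s t p p' :
  on_edge (u m) (u (m + 1)) s p -> on_edge (u n) (u (n + 1)) t p' ->
  polygonal_path p p' `|(m%:~R + s) - (n%:~R + t)|.
Proof.
move=> ps pt; have [mn|/ltW nm] := leP m n.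
  have nE : n = m + (absz (n - m))%:Z by lia.
  by rewrite nE in pt *; exact: polygonal_line_nat.
have mE : m = n + (absz (m - n))%:Z by lia.
rewrite mE in ps *; rewrite distrC; apply: polygonal_path_sym.
exact: polygonal_line_nat.
Qed.

(** [phi] is a coordinate along the line, and its Lipschitz bound equals the length of the path that
    follows the line. *)
Lemma line_geodesic phi : lipschitz1 phi ->
  (forall n, phi (u n) = n%:~R) -> geodesic_line R u.
Proof.
move=> phi1 phin; split=> // m n s t p p' ps pt; have path := polygonal_line ps pt.
apply: le_anti; rewrite tree_dist_le//=.
have := tree_dist_ge phi1 path; rewrite (linextE phi ps) (linextE phi pt) !phin.
rewrite !intrD; congr (`|_| <= _); ring.
Qed.

End Line.
End Realization.

(** * Geodesics of the tree *)

Section ProjectiveLine.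
Variable k : fieldType.
Local Notation F := (laurent k).
Implicit Types (x a b : P1 k) (g : GL2 k).

(* The row vector [(u1, u2)], up to scaling, for which [u1 z + u2] vanishes at
   [z = x]; it spans the line of [F^2] fixed by the stabilizer of [x]. *)
Definition P1_row x : 'rV[F]_2 :=
  \row_j (if x is Some y then if j == 0 then 1 else - y
          else if j == 0 then 0 else 1).

Definition P1_mx a b : 'M[F]_2 :=
  \matrix_(i, j) (if i == 0 then P1_row a 0 j else P1_row b 0 j).

Lemma row_P1_mx a b : row 0 (P1_mx a b) = P1_row a /\ row 1 (P1_mx a b) = P1_row b.
Proof. by split; apply/rowP => j; rewrite !mxE. Qed.

Lemma P1_mx_unit a b : a <> b -> P1_mx a b \in unitmx.
Proof.
move=> ab; rewrite unitmxE unitfE det_I2 !mxE /=.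
case: a b ab => [x|] [y|] ab /=;
  rewrite ?mulr0 ?mul0r ?mulr1 ?mul1r ?subr0 ?sub0r ?oppr_eq0 ?oner_neq0//.
rewrite opprK addrC subr_eq0; apply/eqP => xy; apply: ab; congr Some.
exact: xy.
Qed.

(** The first column of [g] gives homogeneous coordinates of the image of infinity, where the linear
    form of [x] must vanish. *)
Lemma P1_act_None g x : P1_act g None = x <-> (P1_row x *m g) 0 0 = 0.
Proof.
rewrite /P1_act mxE big_I2 !mxE /=.
have g0 : g 0 0 = 0 -> g 1 0 = 0 -> False.
  move=> g00 g10; have := GL2_unit g; rewrite unitmxE unitfE det_I2 g00 g10.
  by rewrite mul0r mulr0 subrr eqxx.
case: x => [y|]; last by rewrite mul0r mul1r add0r; case: eqP.
rewrite mul1r mulNr; have [g10|g10] := eqVneq (g 1 0) 0.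
  by split=> //; rewrite g10 mulr0 subr0 => /g0 /(_ g10).
split=> [[<-]|/eqP]; first by rewrite divfK// subrr.
by rewrite subr_eq0 => /eqP ->; rewrite mulfK.
Qed.

End ProjectiveLine.

(** * Rays and geodesic lines seen through the defect *)

Section Geodesic.
Variables (R : realType) (k : fieldType).
Local Notation F := (laurent k).
Variables (E : 'M[F]_2) (Eu : E \in unitmx).
Local Notation vdefect := (vdefect E).
Local Notation vgap := (vgap E).
Local Notation line := (line Eu).
Local Notation treeR := (treeR R k).
Implicit Types (p : treeR) (u w : vertex k) (g : GL2 k).

Lemma coord_std_vertex g n :
  E *m invmx (std_mx k n *m invmx g) = E *m g *m std_mx k (- n).
Proof.
rewrite invmxM ?std_mx_unit ?unitmx_inv ?GL2_unit// invmxK invmx_std_mx.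
by rewrite mulmxA.
Qed.

Lemma vdefect_act_std g n :
  vdefect (act_vertex g (std_vertex k n)) = defect (E *m g *m std_mx k (- n)).
Proof. by rewrite (vdefectE Eu (rep_act g (rep_std_vertex k n))) coord_std_vertex. Qed.

Lemma vgap_act_std g n :
  vgap (act_vertex g (std_vertex k n)) = gap (E *m g *m std_mx k (- n)).
Proof. by rewrite (vgapE Eu (rep_act g (rep_std_vertex k n))) coord_std_vertex. Qed.

(** In [X = E g] times [diag(pi^-n, 1)], row [i] is [(0, X_i1)], and for large [n] the other row [j]
    has order at least [ord X_j0 - n]. These bounds add up to the order of the determinant, so the
    defect is at most 0. *)
Lemma ray_vdefect g i : (E *m g) i 0 = 0 ->
  exists N : nat, forall n : nat, (N <= n)%N ->
    vdefect (act_vertex g (std_vertex k n)) = 0.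
Proof.
have := GL2_unit g; have : E *m g \in unitmx by rewrite unitmx_mul Eu GL2_unit.
have E0 n := vdefect_act_std g n; move: (E *m g) E0 => X E0 Xu _ Xi0.
pose j : 'I_2 := if i == 0 then 1 else 0.
have dX : \det X = X 0 0 * X 1 1 - X 0 1 * X 1 0 by exact: det_I2.
have ij : (i == 0) = (j == 1) /\ (i == 1) = (j == 0).
  by rewrite /j; move: i {Xi0 j}; apply: forall_I2.
have [Xi1 Xj0] : X i 1 != 0 /\ X j 0 != 0.
  apply/andP; have := det_unitmx_neq0 Xu; rewrite dX -negb_or; apply: contraNN.
  move: i Xi0 @j {ij} => i; move: i; apply: forall_I2 => Xi0 j; rewrite /j /= Xi0.
    by rewrite mul0r sub0r oppr_eq0 mulf_eq0.
  by rewrite mulr0 subr0 mulf_eq0 orbC.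
have [b yb] := laurent_bounded (X j 1).
(* [X j 1] vanishes below [b], hence below [ord X_j0 - n] from this [n] on. *)
exists (absz (ordL (X j 0) - b)%R) => n le_n.
have Mu : X *m std_mx k (- n%:Z) \in unitmx by rewrite unitmx_mul Xu std_mx_unit.
apply: le_anti; rewrite (vdefect_ge0 Eu) andbT E0.
have M_E i' j' := @mul_mx_std k (- n%:Z) X i' j'.
move: (X *m _) Mu M_E => M Mu M_E.
have ri : ordL (X i 1) <= rowval (row i M).
  apply/rowvalP; first exact: row_unitmx_neq0.
  apply/mxge_row2; rewrite mxE M_E Xi0 mul0r mxE M_E mulr1.
  by split; [exact: vanish_below0|case: (ordLP Xi1)].
have rj : ordL (X j 0) - n%:Z <= rowval (row j M).
  apply/rowvalP; first exact: row_unitmx_neq0.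
  apply/mxge_row2; rewrite mxE M_E eqxx mxE M_E mulr1; split.
    by apply: vanish_belowM (@vanish_below_uniformizer k _); case: (ordLP Xj0).
  by apply: vanish_belowW yb _; move: le_n; set x := ordL _; clearbody x; clear; lia.
have dM : ordL (\det M) = ordL (X i 1) + ordL (X j 0) - n%:Z.
  rewrite det_I2 !M_E /= !mulr1.
  move: i Xi0 Xi1 @j Xj0 {ij yb le_n ri rj} => i; move: i; apply: forall_I2 => Xi0 Xi1 j Xj0.
    rewrite Xi0 !mul0r sub0r ordLN !ordLM ?mulf_neq0 ?uniformizer_exp_neq0//.
    by rewrite ordL_uniformizer_exp addrA.
  rewrite Xi0 mul0r mulr0 subr0 !ordLM ?mulf_neq0 ?uniformizer_exp_neq0//.
  by rewrite ordL_uniformizer_exp addrC addrA.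
have -> : defect M = ordL (\det M) - rowval (row i M) - rowval (row j M).
  rewrite /defect /j; move: i {Xi0 Xi1 j Xj0 ij yb le_n ri rj dM}.
  by apply: forall_I2 => /=; ring.
rewrite dM; move: ri rj.
set r0 := rowval _; set r1 := rowval _; set x0 := ordL _; set x1 := ordL _.
by clearbody r0 r1 x0 x1; clear; lia.
Qed.

Lemma opposite_line_subproof : invmx E *m perm_mx (tperm 0 1) \in unitmx.
Proof. by rewrite unitmx_mul unitmx_inv Eu unitmx_perm. Qed.

(** Swapping the columns of [E^-1] exchanges its images of 0 and infinity, so that the vertices
    [v_n] run along the line backwards. *)
Definition E_inv_swap : GL2 k := MkGL2 opposite_line_subproof.

Lemma line_opp n : line (- n) = act_vertex E_inv_swap (std_vertex k n).
Proof.
have [d0 g0] : vdefect (act_vertex E_inv_swap (std_vertex k n)) = 0 /\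
    vgap (act_vertex E_inv_swap (std_vertex k n)) = - n.
  rewrite vdefect_act_std vgap_act_std /= mulKVmx//.
  pose P : 'M[F]_2 := perm_mx (tperm 0 1).
  have PE i j : P i j = (i != j)%:R.
    rewrite !mxE; move: i j; apply: forall_I2; apply: forall_I2;
      by rewrite ?tpermL ?tpermR.
  have M_E i j := @mul_mx_std k (- n) P i j.
  rewrite /defect /gap det_I2 -/P !M_E !PE /=.
  rewrite (@rowval_r _ (row 0 _)) ?(@rowval_l _ (row 1 _)) ?[row _ _ _ _]mxE
    ?M_E ?PE /= ?mul0r ?mulr1 ?mul1r ?oner_neq0 ?uniformizer_exp_neq0//.
  rewrite sub0r ordLN ordL1 ordL_uniformizer_exp.
  by split; ring.
by rewrite [RHS](vdefect0_line Eu d0) g0.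
Qed.

Definition vdefectR u : R := (vdefect u)%:~R.
Definition vgapR u : R := (vgap u)%:~R.

Lemma lipschitz1_vdefect : lipschitz1 vdefectR.
Proof.
move=> u w uw; rewrite /vdefectR -intrB -intr_norm lerz1.
by have := adjacent_step Eu uw; set a := vdefect u; set b := vdefect w;
  set c := vgap u; set d := vgap w; clearbody a b c d; clear; lia.
Qed.

Lemma lipschitz1_vgap : lipschitz1 vgapR.
Proof.
move=> u w uw; rewrite /vgapR -intrB -intr_norm lerz1.
by have := adjacent_step Eu uw; set a := vdefect u; set b := vdefect w;
  set c := vgap u; set d := vgap w; clearbody a b c d; clear; lia.
Qed.

Lemma line_is_geodesic : geodesic_line R line.
Proof.
apply: (line_geodesic (@adjacent_line _ _ Eu) lipschitz1_vgap) => n.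
by rewrite /vgapR vgap_line.
Qed.

Lemma flat_edge_on_line u w t p : on_edge u w t p ->
  vdefect u = 0 -> vdefect w = 0 -> on_line line p.
Proof.
move=> pt u0 w0; have [uw _ _] := pt.
have := adjacent_step Eu uw; rewrite u0 w0.
have uE := vdefect0_line Eu u0; have wE := vdefect0_line Eu w0.
move: (vgap u) (vgap w) uE wE => m n uE wE mn.
have [nE|mE] : n = m + 1 \/ m = n + 1 by move: mn; clear; lia.
  by exists m, t; rewrite -nE -uE -wE; exact: pt.
by exists n, (1 - t); rewrite -mE -uE -wE; exact: on_edgeC.
Qed.

Lemma on_line_vdefect p : on_line line p -> linext vdefectR p = 0.
Proof.
move=> [n [t /linextE ->]].
by rewrite /vdefectR !vdefect_line !mulr0 addr0.
Qed.

(** Each step spends one unit, either on the defect or on the gap. *)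
Lemma geodesic_line_step (v : int -> vertex k) (n : int) (d : nat) :
  (forall m, adjacent (v m) (v (m + 1))) ->
  `|vdefect (v n) - vdefect (v (n + d%:Z))| + `|vgap (v n) - vgap (v (n + d%:Z))| <= d%:Z.
Proof.
move=> adj; elim: d => [|d IH].
  have -> : n + 0%N%:Z = n by exact: addr0.
  by move: (vdefect _) (vgap _); clear; lia.
have := adjacent_step Eu (adj (n + d%:Z)).
have <- : n + d.+1%:Z = n + d%:Z + 1 by lia.
move: IH; move: (vdefect (v n)) (vdefect (v _)) (vdefect _).
move: (vgap (v n)) (vgap (v _)) (vgap _).
by clear; lia.
Qed.

(** The vertices at [-N] and [N] are on [line], and their distance [2N] forces their gaps to differ
    by at least [2N]. The [2N] steps between them then all go into the gap and none into the
    defect. *)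
Lemma geodesic_vdefect0 (v : int -> vertex k) (N : nat) (n : int) : geodesic_line R v ->
  vdefect (v (- N%:Z)) = 0 -> vdefect (v N%:Z) = 0 -> `|n| <= N%:Z -> vdefect (v n) = 0.
Proof.
move=> [adj dist] v0 v1 nN.
have z01 : 0 <= (0 : R) <= 1 by rewrite lexx ler01.
have [p0 p0E] := on_edge_ex (adj (- N%:Z)) z01.
have [p1 p1E] := on_edge_ex (adj N%:Z) z01.
have vE0 := vdefect0_line Eu v0; have vE1 := vdefect0_line Eu v1.
have on_line0 (w w' : vertex k) m p : w = line m -> on_edge w w' 0 p ->
    on_edge (line m) (line (m + 1)) 0 p.
  move=> wE [_ _ pE]; split=> //; first exact: adjacent_line.
  by rewrite pE wE !edge_coord0.
have [m0 m0E] : exists m, m = vgap (v (- N%:Z)) := ex_intro _ _ erefl.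
have [m1 m1E] : exists m, m = vgap (v N%:Z) := ex_intro _ _ erefl.
rewrite -m0E in vE0; rewrite -m1E in vE1.
have le_m : `|- N%:Z - N%:Z| <= `|m0 - m1|.
  have := tree_dist_le (polygonal_line (@adjacent_line _ _ Eu)
    (on_line0 _ _ _ _ vE0 p0E) (on_line0 _ _ _ _ vE1 p1E)).
  rewrite (dist _ _ _ _ _ _ p0E p1E).
  by rewrite [X in `|X - _|]addr0 [X in `|_ - X|]addr0 [X in _ <= `|X - _|]addr0
    [X in _ <= `|_ - X|]addr0 -!intrB -!intr_norm ler_int.
have n0 : n = - N%:Z + (absz (n + N%:Z))%:Z by lia.
have n1 : N%:Z = n + (absz (N%:Z - n))%:Z by lia.
have := geodesic_line_step (- N%:Z) (absz (n + N%:Z)) adj; rewrite -n0 v0.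
have := geodesic_line_step n (absz (N%:Z - n)) adj; rewrite -n1 v1.
move: m0E m1E le_m nN; move: (vdefect (v n)) (vgap (v n))
  (vgap (v (- N%:Z))) (vgap (v N%:Z)).
by clear; lia.
Qed.

End Geodesic.

(** * The defect as the distance to the geodesic *)

Section DistanceToGeodesic.
Variables (R : realType) (k : fieldType).
Variables (a b : P1 k) (Eu : P1_mx a b \in unitmx).
Local Notation E := (P1_mx a b).
Local Notation vdefect := (vdefect E).
Local Notation line := (line Eu).
Local Notation treeR := (treeR R k).
Local Notation dist := (linext (vdefectR R E)).
Implicit Types (p : treeR) (u w : vertex k) (g : GL2 k) (x : P1 k).

Lemma eventually_vdefect0 (r : nat -> vertex k) x i :
  row i E = P1_row x -> ray_represents r x ->
  exists N : nat, forall n : nat, (N <= n)%N -> vdefect (r n) = 0.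
Proof.
move=> Ei [g /P1_act_None gx [m [n rE]]].
have [N NP] : exists N : nat, forall n : nat, (N <= n)%N ->
    vdefect (act_vertex g (std_vertex k n)) = 0.
  (* That [g] sends infinity to [x] says that entry [(i, 0)] of [E g] is zero. *)
  apply: (ray_vdefect Eu (i := i)); rewrite -[RHS]gx -Ei -row_mul.
  by rewrite [RHS]mxE.
exists (m + N)%N => j le_j.
rewrite (_ : j = m + (j - m))%N; last by lia.
by rewrite rE; apply: NP; lia.
Qed.

Lemma on_line_geodesic p : on_line line p -> @geodesic R k a b p.
Proof.
move=> p_line; exists line; split=> //; first exact: line_is_geodesic.
  exists (E_inv_swap Eu).
    apply/P1_act_None; rewrite /= -(row_P1_mx a b).1 -row_mul mulKVmx//.
    by rewrite !mxE tpermL.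
  by exists 0%N, 0%N => i; rewrite !add0n; exact: line_opp.
exists (E_inv Eu); last by exists 0%N, 0%N.
by apply/P1_act_None; rewrite /= -(row_P1_mx a b).2 -row_mul mulmxV// !mxE.
Qed.

Lemma geodesicE : @geodesic R k a b = on_line line.
Proof.
apply/seteqP; split=> [p|p]; last exact: on_line_geodesic.
move=> [u [u_geo /(eventually_vdefect0 (row_P1_mx a b).1)[Na NaP]
  /(eventually_vdefect0 (row_P1_mx a b).2)[Nb NbP] [n [t pt]]]].
have u0 m : vdefect (u m) = 0.
  (* Large enough for both rays to have reached defect 0 and for [m] to lie between [-N] and [N]. *)
  pose N := maxn (maxn Na Nb) (absz m).
  by apply: (geodesic_vdefect0 (N := N) Eu u_geo); [apply: NaP|apply: NbP|]; lia.
exact: flat_edge_on_line pt (u0 _) (u0 _).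
Qed.

Lemma descent_path (d : nat) u p : vdefect u = d%:Z ->
  (bary p = fun v => `[< v = u >]%:R) ->
  exists2 p', on_line line p' & polygonal_path p p' d%:R.
Proof.
elim: d u p => [|d IH] u p ud pE.
  exists p; last exact: polygonal_nil.
  exists (vgap E u), 0; rewrite -vdefect0_line//; split; rewrite ?lexx ?ler01//.
    by rewrite {1}(vdefect0_line Eu ud); exact: adjacent_line.
  by rewrite edge_coord0.
have [|w uw wd] := @vdefect_descent _ _ Eu u; first by rewrite ud.
have [p' p'1] := @on_edge_ex R _ _ _ 1 uw (introT andP (conj ler01 (lexx 1))).
have p0 : on_edge u w 0 p by split; rewrite ?lexx ?ler01// edge_coord0.
have [_ _ p'E] := p'1; rewrite edge_coord1 in p'E.
have wd' : vdefect w = d%:Z by rewrite wd ud; clear; lia.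
have [p'' p''_line p'p''] := IH w p' wd' p'E.
exists p'' => //; have := polygonal_path_trans (polygonal_path_segment p0 p'1) p'p''.
by rewrite sub0r normrN normr1 -[d.+1%:R]natr1 addrC.
Qed.

(** The path first runs to the endpoint [w] of smaller defect, at distance [1 - t], and then
    descends; [(1 - t) + vdefect w] is the interpolated defect of [p]. *)
Lemma edge_path u w t p : on_edge u w t p -> vdefect u = vdefect w + 1 ->
  exists2 p', on_line line p' & polygonal_path p p' (dist p).
Proof.
move=> pt uE; have [uw _ _] := pt.
have [q q1] := @on_edge_ex R _ _ _ 1 uw (introT andP (conj ler01 (lexx 1))).
have w0 := vdefect_ge0 Eu w.
have [d dE] : exists d : nat, vdefect w = d%:Z.
  by exists (absz (vdefect w)); rewrite gez0_abs.
have [_ _ qE] := q1; rewrite edge_coord1 in qE.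
have [p' p'_line qp'] := descent_path dE qE.
exists p' => //; have := polygonal_path_trans (polygonal_path_segment pt q1) qp'.
congr polygonal_path; rewrite (linextE _ pt) /vdefectR uE dE intrD.
have [_ /andP[_ t1] _] := pt.
by rewrite ler0_norm ?subr_le0//; ring.
Qed.

Lemma path_to_line p : exists2 p', on_line line p' & polygonal_path p p' (dist p).
Proof.
have [[[u w] t] /= pt] := on_edge_exists p; have [uw _ _] := pt.
have [uE|] := eqVneq (vdefect u) (vdefect w).
  have u0 := adjacent_flat Eu uw uE.
  have w0 : vdefect w = 0 := etrans (esym uE) u0.
  have p_line : on_line line p := flat_edge_on_line Eu pt u0 w0.
  exists p; first exact: p_line.
  by rewrite (on_line_vdefect p_line); exact: polygonal_nil.
have := adjacent_step Eu uw; move: (edge_path pt) (edge_path (on_edgeC pt)).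
move: (vdefect u) (vdefect w) (vgap _ _) (vgap _ _) => m n c d.
move=> Hu Hw mn1 mn; have [mE|nE] : m = n + 1 \/ n = m + 1.
- by move: mn1 mn; clear; lia.
- exact: Hu.
- exact: Hw.
Qed.

(** [path_to_line] gives the upper bound; the lower one holds because the defect is 1-Lipschitz and
    vanishes on the line. *)
Lemma dist_to_geodesic p : dist_to_set p (@geodesic R k a b) = dist p.
Proof.
rewrite geodesicE /dist_to_set; have [p1 p1_line pp1] := path_to_line p.
have dist_lb p' : on_line line p' -> dist p <= tree_dist p p'.
  move=> p'_line; have [n [s p1s]] := p1_line; have [m [t p't]] := p'_line.
  (* [tree_dist_ge] asks for some path from [p] to [p']; this one goes through [p1]. *)
  have p1p' := polygonal_line (@adjacent_line _ _ Eu) p1s p't.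
  have := tree_dist_ge (lipschitz1_vdefect R Eu) (polygonal_path_trans pp1 p1p').
  rewrite (on_line_vdefect p'_line) subr0; apply: le_trans.
  exact: ler_norm.
apply: le_anti; apply/andP; split; last first.
  apply: lb_le_inf; first by exists (tree_dist p p1), p1.
  by move=> _ [p' p'_line <-]; exact: dist_lb.
apply: le_trans (tree_dist_le pp1); apply: ge_inf; last by exists p1.
by exists (dist p) => _ [p' p'_line <-]; exact: dist_lb.
Qed.

End DistanceToGeodesic.

(** * The valuation of C_oo *)

Section Valuation.
Variables (R : realType) (k : finFieldType) (C : fieldType).
Variables (iota : {rmorphism laurent k -> C}) (ord : C -> \bar R).
Hypothesis C_inf : is_Cinf iota ord.
Local Notation F := (laurent k).
Local Notation unif := (uniformizer k).
Implicit Types (z w : C) (x y : F).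

(** [fine] sends the infinite order of 0 to 0. *)
Definition ordC z : R := fine (ord z).

Lemma ordE z : z != 0 -> ord z = (ordC z)%:E.
Proof.
move=> z0; rewrite fineK// fin_numE (ord_eqNy C_inf) /=.
by apply/eqP => /(ord_eqy C_inf)/eqP; rewrite (negPf z0).
Qed.

Lemma ord_0 : ord 0 = +oo%E.
Proof. exact/(ord_eqy C_inf). Qed.

Lemma ordCM z w : z != 0 -> w != 0 -> ordC (z * w) = ordC z + ordC w.
Proof. by move=> z0 w0; rewrite /ordC (ordM C_inf) !ordE. Qed.

Lemma ordC1 : ordC 1 = 0.
Proof.
have /eqP := @ordCM 1 1 (oner_neq0 _) (oner_neq0 _).
by rewrite mulr1 -subr_eq0 opprD addNKr oppr_eq0 => /eqP.
Qed.

Lemma ordCV z : z != 0 -> ordC z^-1 = - ordC z.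
Proof.
by move=> z0; apply/eqP; rewrite -addr_eq0 -ordCM ?invr_neq0// mulVf// ordC1.
Qed.

Lemma ordCN z : ordC (- z) = ordC z.
Proof.
have [->|z0] := eqVneq z 0; first by rewrite oppr0.
have N10 : -1 != 0 :> C by rewrite oppr_eq0 oner_neq0.
have : ordC (-1) + ordC (-1) = 0 by rewrite -ordCM// mulrNN mulr1 ordC1.
rewrite -mulr2n => /eqP; rewrite mulrn_eq0 /= => /eqP N1.
by rewrite -mulN1r ordCM// N1 add0r.
Qed.

Lemma ordN z : ord (- z) = ord z.
Proof.
have [->|z0] := eqVneq z 0; first by rewrite oppr0.
by rewrite !ordE ?oppr_eq0// ordCN.
Qed.

Lemma ordC_iota x : x != 0 -> ordC (iota x) = (ordL x)%:~R.
Proof.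
move=> x0; have [xo xo0] := ordLP x0.
by rewrite /ordC (ord_laurent C_inf xo xo0).
Qed.

Lemma ordD_ge (r : \bar R) z w : (r <= ord z)%E -> (r <= ord w)%E -> (r <= ord (z + w))%E.
Proof.
by move=> rz rw; apply: le_trans (ordD C_inf z w); rewrite le_min rz rw.
Qed.

Lemma ordB_ge (r : \bar R) z w : (r <= ord z)%E -> (r <= ord w)%E -> (r <= ord (z - w))%E.
Proof. by move=> rz rw; apply: ordD_ge; rewrite ?ordN. Qed.

Lemma q_of_gt1 : 1 < q_of R k.
Proof. by rewrite /q_of ltr1n card_finNzRing_gt1. Qed.

Lemma absvE z : z != 0 -> absv k ord z = q_of R k `^ (- ordC z).
Proof. by move=> z0; rewrite /absv ordE. Qed.

Lemma absv_ge0 z : 0 <= absv k ord z.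
Proof. by rewrite /absv; case: (ord z) => // r; exact: powR_ge0. Qed.

Lemma absv_le z w : z != 0 -> w != 0 ->
  (absv k ord z <= absv k ord w) = (ordC w <= ordC z).
Proof.
move=> z0 w0; rewrite !absvE// -[RHS]lerN2.
apply/idP/idP => [|le_zw]; last by apply: ler_powR => //; exact/ltW/q_of_gt1.
apply: contraTT; rewrite -!ltNge => lt_wz; rewrite /powR.
have q0 : q_of R k == 0 = false by apply/gt_eqF/lt_trans/q_of_gt1.
by rewrite q0 ltr_expR ltr_pM2r// ln_gt0// q_of_gt1.
Qed.

Lemma log_q_absv z : z != 0 -> log_q k (absv k ord z) = - ordC z.
Proof.
move=> z0; rewrite /log_q absvE// ln_powR mulfK//.
by rewrite gt_eqF// ln_gt0// q_of_gt1.
Qed.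

(** Greatest order means least absolute value. For [z] in Omega no difference is 0, so the default
    of [ordC] does not interfere. *)
Definition nearest z x := forall y, ordC (z - iota y) <= ordC (z - iota x).

Lemma Omega_subr_neq0 (z : Omega iota) y : (z : C) - iota y != 0.
Proof. by rewrite subr_eq0; apply/eqP; exact: omegaP. Qed.

Lemma abs_i_nearest (z : Omega iota) x : nearest z x ->
  abs_i iota ord z = absv k ord ((z : C) - iota x).
Proof.
move=> zx; apply: le_anti; apply/andP; split.
  by apply: ge_inf; [exists 0 => _ [y _ <-]; exact: absv_ge0|exists x].
apply: lb_le_inf; first by exists (absv k ord ((z : C) - iota x)), x.
by move=> _ [y _ <-]; rewrite absv_le ?Omega_subr_neq0.
Qed.

Lemma ord_iota_ge x (n : int) : vanish_below x n -> ((n%:~R)%:E <= ord (iota x))%E.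
Proof.
have [->|x0] := eqVneq x 0; first by rewrite rmorph0 ord_0 leey.
move=> xn; rewrite ordE ?fmorph_eq0// lee_fin ordC_iota// ler_int.
exact: ordL_ge.
Qed.

(* Every [ord (z - y)] that is not maximal is the order of an element of [F],
   hence an integer; if these integers were unbounded, then [z] would be a limit
   of elements of [F], which is complete. *)
Lemma nearest_exists (z : Omega iota) : exists x, nearest z x.
Proof.
apply: contrapT => no_nearest.
have z_neq0 := Omega_subr_neq0 z.
have better x : exists y, ordC ((z : C) - iota x) < ordC ((z : C) - iota y).
  apply: contrapT => nx; apply: no_nearest; exists x => y.
  by rewrite leNgt; apply/negP => xy; apply: nx; exists y.
have integral x : exists m : int, ordC ((z : C) - iota x) = m%:~R.
  have [y xy] := better x; have yx : y - x != 0.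
    by apply: contraTneq xy => /eqP; rewrite subr_eq0 => /eqP ->; rewrite ltxx.
  exists (ordL (y - x)); rewrite -ordC_iota//; apply: le_anti; apply/andP; split.
    rewrite -lee_fin -!ordE ?fmorph_eq0//.
    rewrite (_ : iota (y - x) = ((z : C) - iota x) - ((z : C) - iota y)); last first.
      by rewrite rmorphB; ring.
    by apply: ordB_ge => //; rewrite !ordE// lee_fin ltW.
  rewrite leNgt; apply/negP => lt_x.
  have : ((Order.min (ordC (iota (y - x))) (ordC ((z : C) - iota y)))%R%:E <=
    ord ((z : C) - iota x)%R)%E.
    rewrite (_ : (z : C) - iota x = iota (y - x) + ((z : C) - iota y)); last first.
      by rewrite rmorphB; ring.
    by apply: ordD_ge; rewrite ordE ?fmorph_eq0// lee_fin ge_min lexx ?orbT.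
  by rewrite ordE// lee_fin leNgt lt_min lt_x xy.
(* All the orders are integers here, so each improvement gains at least 1. *)
have approx (n : nat) : exists x, n%:R <= ordC ((z : C) - iota x).
  have [m0 m0E] := integral 0.
  suff H (d : nat) : exists x, (m0 + d%:Z)%:~R <= ordC ((z : C) - iota x).
    have [x] := H (absz (n%:Z - m0)%R); exists x; apply: le_trans p.
    by rewrite -[n%:R]/(n%:Z%:~R) ler_int; lia.
  elim: d => [|d [x xd]]; first by exists 0; rewrite m0E ler_int addr0.
  have [y xy] := better x; exists y; have [m mE] := integral y.
  move: xy xd; have [m' m'E] := integral x.
  by rewrite mE m'E ltr_int !ler_int; lia.
have [x xP] := choice approx.
have x_cauchy (m n : nat) : (m <= n)%N -> vanish_below (x n - x m) m.
  move=> mn; have [->|xnm] := eqVneq (x n - x m) 0; first exact: vanish_below0.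
  apply/vanish_below_ordL => //; rewrite -(ler_int R) -ordC_iota//.
  rewrite -lee_fin -ordE ?fmorph_eq0//.
  rewrite (_ : iota _ = ((z : C) - iota (x m)) - ((z : C) - iota (x n))); last first.
    by rewrite rmorphB; ring.
  apply: ordB_ge; rewrite ordE// lee_fin; first exact: xP.
  by apply: le_trans (xP n); rewrite ler_nat.
have [b x0b] := laurent_bounded (x 0%N).
(* The coefficientwise limit: coefficient [i] is stable from the index [|i| + 1] on, since later
   differences vanish below [|i| + 1 > i]. *)
pose f (i : int) : k := x (absz i).+1 i.
have fE (n : nat) (i : int) : i < n%:Z -> f i = x n i.
  move=> i_n; rewrite /f; have [le|le] := leqP n (absz i).+1.
    have := x_cauchy _ _ le i i_n.
    by rewrite laurentD laurentN => /eqP; rewrite subr_eq0 => /eqP.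
  have i_lt : i < (absz i).+1%:Z by lia.
  have := x_cauchy _ _ (ltnW le) i i_lt.
  by rewrite laurentD laurentN => /eqP; rewrite subr_eq0 => /eqP.
have fL : laurent_pred f.
  apply/asboolP; exists (Order.min 0 b) => i; rewrite lt_min => /andP[i0 ib].
  by rewrite (fE 0%N)// x0b.
pose y := Laurent fL.
have y_ge (n : nat) : ((n%:R : R)%:E <= ord ((z : C) - iota y))%E.
  rewrite (_ : (z : C) - iota y = ((z : C) - iota (x n)) - iota (y - x n)); last first.
    by rewrite rmorphB; ring.
  apply: ordB_ge; first by rewrite ordE// lee_fin xP.
  apply: (@ord_iota_ge _ n%:Z) => i i_n.
  by rewrite laurentD laurentN -[y i]/(f i) (fE n i i_n) subrr.
(* The bound fails at the integer just above the finite order of [z - y]. *)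
have := y_ge (Num.truncn (ordC ((z : C) - iota y))).+1.
by rewrite ordE// lee_fin leNgt truncnS_gt.
Qed.

Lemma ord_sum_gt (I : Type) (r : seq I) (P : pred I) (f : I -> C) (c : R) :
  (forall i, P i -> (c%:E < ord (f i))%E) -> (c%:E < ord (\sum_(i <- r | P i) f i))%E.
Proof.
move=> fc; elim/big_ind: _ => [|u v cu cv|i]; last exact: fc.
  by rewrite ord_0 ltry.
by apply: lt_le_trans (ordD C_inf u v); rewrite lt_min cu cv.
Qed.

Lemma ordC_exp z n : z != 0 -> ordC (z ^+ n) = n%:R * ordC z.
Proof.
move=> z0; elim: n => [|n IH]; first by rewrite expr0 ordC1 mul0r.
by rewrite exprS ordCM ?expf_neq0// IH -natr1 mulrDl mul1r addrC.
Qed.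

(* In an algebraic relation over [F] two terms must have the same order. *)
Lemma ordC_root_rat (p : {poly F}) z : p != 0 -> root (map_poly iota p) z ->
  z != 0 -> exists s : rat, ordC z = ratr s.
Proof.
move=> p0 /rootP pz z0.
have pzE : \sum_(i < size p) iota p`_i * z ^+ i = 0.
  rewrite -[RHS]pz horner_coef size_map_poly; apply: eq_bigr => i _.
  by rewrite coef_map.
have ps : (0 < size p)%N by rewrite size_poly_gt0.
have ltp : ((size p).-1 < size p)%N by rewrite prednK.
pose i0 := Ordinal ltp; pose P (i : 'I_(size p)) := p`_i != 0.
have Pi0 : P i0 by rewrite /P /= -lead_coefE lead_coef_eq0.
pose f (i : 'I_(size p)) := (ordL p`_i)%:~R + i%:R * ordC z.
have fE i : P i -> ord (iota p`_i * z ^+ i) = (f i)%:E.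
  move=> Pi; rewrite ordE ?mulf_neq0 ?fmorph_eq0 ?expf_neq0//.
  by rewrite ordCM ?fmorph_eq0 ?expf_neq0// ordC_iota// ordC_exp.
case: (arg_minP f Pi0) => i Pi imin.
(* If term [i] alone had the least order, the sum of the others, which is its opposite, would have
   larger order. *)
have [j /andP[Pj ji] fij] : exists2 j, P j && (j != i) & f j = f i.
  apply: contrapT => nj.
  have : ((f i)%:E < ord (\sum_(j < size p | j != i) iota p`_j * z ^+ j))%E.
    apply: ord_sum_gt => j ji; have [pj|Pj] := eqVneq p`_j 0.
      by rewrite pj rmorph0 mul0r ord_0 ltry.
    rewrite fE// lte_fin lt_neqAle imin// andbT; apply/eqP => fij.
    by apply: nj; exists j; rewrite // /P Pj.
  move: pzE; rewrite (bigD1 i)//= => /eqP; rewrite addrC addr_eq0 => /eqP ->.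
  by rewrite ordN fE// ltxx.
have ij : (j%:R - i%:R : rat) != 0 by rewrite subr_eq0 eqr_nat.
(* Solves [ord p_i + i ord z = ord p_j + j ord z] for [ord z]. *)
exists (((ordL p`_i)%:~R - (ordL p`_j)%:~R) / (j%:R - i%:R)).
have ijR : (j%:R - i%:R : R) != 0 by rewrite subr_eq0 eqr_nat.
rewrite fmorph_div !rmorphB /= !ratr_int !ratr_nat.
apply: (mulIf ijR); rewrite divfK//; move: fij; rewrite /f.
by move: (ordC z) ((ordL _)%:~R : R) ((ordL _)%:~R : R) (i%:R : R) (j%:R : R) => *; lra.
Qed.

(** By density some algebraic element is closer to [z] than [|z|]; it has the same order as [z], and
    [ordC_root_rat] applies to it. *)
Lemma ordC_rat z : z != 0 -> exists s : rat, ordC z = ratr s.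
Proof.
move=> z0; have [K [i [j [ji alg dense]]]] := Cinf_algclosure C_inf.
have az0 : 0 < absv k ord z.
  by rewrite absvE// powR_gt0// (lt_trans _ q_of_gt1).
have [y zy] := dense z _ az0.
have [w wE] : exists w, w = j y by exists (j y).
rewrite -wE in zy.
have w0 : w != 0 by apply: contraTneq zy => ->; rewrite subr0 ltxx.
have ordw : ordC w = ordC z.
  have [zw|zw] := eqVneq (z - w) 0.
    by move/eqP: zw; rewrite subr_eq0 => /eqP ->.
  have lt_zw : ordC z < ordC (z - w) by move: zy; rewrite !ltNge absv_le.
  apply: le_anti; apply/andP; split; last first.
    rewrite -lee_fin -!ordE// (_ : w = z - (z - w)); last by rewrite subKr.
    by apply: ordB_ge => //; rewrite !ordE// lee_fin ltW.
  rewrite leNgt; apply/negP => lt_w.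
  have : ((Order.min (ordC w) (ordC (z - w)))%R%:E <= ord z)%E.
    rewrite -{2}[z](subrK w); apply: ordD_ge; rewrite ordE// lee_fin ge_min lexx ?orbT//.
  by rewrite ordE// lee_fin leNgt lt_min lt_w lt_zw.
have [p p0 py] := alg y; rewrite -ordw; apply: (ordC_root_rat p0) => //.
have -> : map_poly iota p = map_poly j (map_poly i p).
  by rewrite -map_poly_comp; apply: eq_map_poly => x; rewrite /= ji.
by rewrite wE fmorph_root.
Qed.

End Valuation.

(** * The building map *)

Lemma act_on_edge (R : realType) (k : fieldType) (g : GL2 k) (u w : vertex k) (t : R)
    (p : treeR R k) :
  on_edge u w t p -> on_edge (act_vertex g u) (act_vertex g w) t (act_point g p).
Proof.
move=> [uw t01 pE]; split=> //; first exact: act_adjacent.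
apply/funext => v; rewrite /= pE /edge_coord.
have E v' : (act_vertex (GL2_inv g) v = v') = (v = act_vertex g v').
  by apply/propext; split=> [<-|->]; rewrite ?act_vertexVK ?act_vertexK.
by rewrite !E.
Qed.


Section BuildingMap.
Variables (R : realType) (k : finFieldType) (C : fieldType).
Variables (iota : {rmorphism laurent k -> C}) (ord : C -> \bar R).
Hypothesis C_inf : is_Cinf iota ord.
Local Notation F := (laurent k).
Local Notation unif := (uniformizer k).
Local Notation ordC := (ordC ord).
Local Notation nearest := (nearest iota ord).
Implicit Types (x y : F) (z w : Omega iota).

Lemma Omega_eq z w : (z : C) = w -> z = w.
Proof.
case: z w => [z zP] [w wP] /= zw; subst w; congr MkOmega; exact: Prop_irrelevance.
Qed.

(* The norm [(x, y) |-> |x w + y|] is [max (|x| |w|, |y|)] when [0] is nearest to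
   [w]; its logarithm is affine on the edge from [v_0] to [v_{-1}]. *)
Lemma ordC_rowval w (t : R) (v v' : 'rV[F]_2) : nearest w 0 -> ordC w = t ->
  0 <= t <= 1 -> v != 0 -> v' 0 0 = v 0 0 * unif -> v' 0 1 = v 0 1 ->
  ordC (iota (v 0 0) * (w : C) + iota (v 0 1)) =
    (1 - t) * (rowval v)%:~R + t * (rowval v')%:~R.
Proof.
move=> w_near wt /andP[t0 t1] v0 v'0 v'1.
have w0 : (w : C) != 0 by have := Omega_subr_neq0 w 0; rewrite rmorph0 subr0.
have u0 := uniformizer_neq0 k.
have ordu : ordL unif = 1 by exact: (ordL_uniformizer_exp k 1).
have [x0|x0] := eqVneq (v 0 0) 0.
  have y0 : v 0 1 != 0.
    by apply: contraNneq v0 => y0; apply/eqP/rowP; apply: forall_I2; rewrite mxE.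
  rewrite x0 rmorph0 mul0r add0r (ordC_iota C_inf)//.
  by rewrite !rowval_r ?v'0 ?v'1 ?x0 ?mul0r//; ring.
have v'00 : v' 0 0 != 0 by rewrite v'0 mulf_neq0.
have ix0 : iota (v 0 0) != 0 by rewrite fmorph_eq0.
have ordxw : ordC (iota (v 0 0) * (w : C)) = (ordL (v 0 0))%:~R + t.
  by rewrite (ordCM C_inf)// (ordC_iota C_inf)// wt.
have ord'0 : ordL (v' 0 0) = ordL (v 0 0) + 1 by rewrite v'0 ordLM// ordu.
have [y0|y0] := eqVneq (v 0 1) 0.
  rewrite y0 rmorph0 addr0 ordxw !rowval_l ?v'1// ord'0 intrD.
  by ring.
have v'10 : v' 0 1 != 0 by rewrite v'1.
have iy0 : iota (v 0 1) != 0 by rewrite fmorph_eq0.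
(* The zero of the form. As 0 is nearest to [w], the order of [w - y] is at most [ord w]. *)
pose y := - (v 0 1 / v 0 0).
have xwyE : iota (v 0 0) * (w : C) + iota (v 0 1) = iota (v 0 0) * ((w : C) - iota y).
  by rewrite mulrBr -rmorphM /y mulrN mulrCA divff// mulr1 rmorphN opprK.
have wy0 := Omega_subr_neq0 w y.
have xwy0 : iota (v 0 0) * (w : C) + iota (v 0 1) != 0 by rewrite xwyE mulf_neq0.
have le_xw : ordC (iota (v 0 0) * (w : C) + iota (v 0 1)) <= (ordL (v 0 0))%:~R + t.
  rewrite -ordxw xwyE !(ordCM C_inf)// lerD2l.
  by have := w_near y; rewrite rmorph0 subr0.
have -> : ordC (iota (v 0 0) * (w : C) + iota (v 0 1)) =
    Num.min ((ordL (v 0 0))%:~R + t) (ordL (v 0 1))%:~R.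
  apply: le_anti; rewrite le_min le_xw /=; apply/andP; split.
    rewrite -(ordC_iota C_inf)// -lee_fin -!(ordE C_inf)//.
    rewrite [X in (_ <= ord X)%E](_ : _ = (iota (v 0 0) * (w : C) + iota (v 0 1)) -
      iota (v 0 0) * (w : C)); last by rewrite addrC addKr.
    apply: (ordB_ge C_inf) => //.
    by rewrite !(ordE C_inf) ?mulf_neq0// lee_fin ordxw.
  rewrite -lee_fin -(ordE C_inf)//; apply: (ordD_ge C_inf).
    by rewrite (ordE C_inf) ?mulf_neq0// lee_fin ge_min ordxw lexx.
  by rewrite (ordE C_inf)// lee_fin ge_min (ordC_iota C_inf)// lexx orbT.
rewrite !rowval_min// ord'0 v'1.
(* The orders of the entries are integers and [0 <= t <= 1], so the same term is the least at both
   ends of the edge and in between. *)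
have [le_xy|lt_yx] := leP (ordL (v 0 1)) (ordL (v 0 0)).
  have le_xy1 : ordL (v 0 1) <= ordL (v 0 0) + 1 by apply: le_trans le_xy _; rewrite lerDl.
  rewrite (min_idPr le_xy1).
  have /min_idPr -> : ((ordL (v 0 1))%:~R <= (ordL (v 0 0))%:~R + t :> R).
    by apply: ler_wpDr => //; rewrite ler_int.
  by ring.
have le_yx1 : ordL (v 0 0) + 1 <= ordL (v 0 1) by rewrite lezD1.
rewrite (min_idPl le_yx1).
have /min_idPl -> : ((ordL (v 0 0))%:~R + t <= (ordL (v 0 1))%:~R :> R).
  by move: le_yx1; rewrite -(ler_int R) intrD; apply: le_trans; rewrite lerD2l.
by rewrite intrD; ring.
Qed.

Definition affine_mx (c x : F) : 'M[F]_2 :=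
  \matrix_(i, j) (if i == 0 then if j == 0 then c else x
                  else if j == 0 then 0 else 1).

Lemma det_affine_mx c x : \det (affine_mx c x) = c.
Proof. by rewrite det_I2 !mxE /= mulr1 mulr0 subr0. Qed.

Lemma affine_mx_unit c x : c != 0 -> affine_mx c x \in unitmx.
Proof. by move=> c0; rewrite unitmxE det_affine_mx unitfE. Qed.

Definition affine c x (c0 : c != 0) : GL2 k := MkGL2 (affine_mx_unit x c0).

Lemma affine_act c x (c0 : c != 0) w :
  act_Omega (affine x c0) w = iota c * (w : C) + iota x :> C.
Proof.
by rewrite /= /moebius /= !mxE /= rmorph0 rmorph1 mul0r add0r divr1.
Qed.

(* Every orbit meets the closed edge from [v_0] to [v_{-1}]. *)
Lemma Omega_reduction z : exists (m : int) x w (t : rat),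
  [/\ act_Omega (affine x (uniformizer_exp_neq0 k m)) w = z,
    nearest z x, nearest w 0, ordC w = ratr t & 0 <= t <= 1].
Proof.
have [x zx] := nearest_exists C_inf z; have zx0 := Omega_subr_neq0 z x.
have [s sE] := ordC_rat C_inf zx0.
(* Scaling by [pi^-m] leaves the fractional part [t] as the order of [w]. *)
pose m := Num.floor s; pose t := s - m%:~R.
have c0 := uniformizer_exp_neq0 k m.
have ic0 : iota (unif ^ m) != 0 by rewrite fmorph_eq0.
have ordc : ordC (iota (unif ^ m)) = m%:~R.
  by rewrite (ordC_iota C_inf)// ordL_uniformizer_exp.
have wP y : ((z : C) - iota x) / iota (unif ^ m) <> iota y.
  move=> wy; apply: (@omegaP _ _ _ z (y * unif ^ m + x)).
  by rewrite rmorphD rmorphM -wy divfK// subrK.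
have wE y : ((z : C) - iota x) / iota (unif ^ m) - iota y =
    ((z : C) - iota (y * unif ^ m + x)) / iota (unif ^ m).
  apply: (mulIf ic0); rewrite mulrBl !divfK// -rmorphM rmorphD opprD.
  by rewrite addrA addrAC.
have w_ord y : ordC (((z : C) - iota x) / iota (unif ^ m) - iota y) =
    ordC ((z : C) - iota (y * unif ^ m + x)) - m%:~R.
  have zy0 := Omega_subr_neq0 z (y * unif ^ m + x).
  by rewrite wE (ordCM C_inf) ?invr_neq0// (ordCV C_inf)// ordc.
exists m, x, (MkOmega wP), t; split.
- by apply: Omega_eq; rewrite affine_act /= mulrCA divff// mulr1 subrK.
- exact: zx.
- by move=> y; rewrite !w_ord lerD2r mul0r add0r.
- have := w_ord 0; rewrite rmorph0 subr0 /= => ->.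
  by rewrite mul0r add0r sE rmorphB /= ratr_int.
- rewrite subr_ge0 ge_floor lerBlDl /=.
  by have := floorD1_gt s; rewrite intrD => /ltW.
Qed.

Variable lambda : Omega iota -> treeR R k.
Hypothesis lambdaP : is_building_map ord lambda.

(** As 0 is nearest to [w], [|w| = |w|_i = q^-t], which places [w] in the prescribed fibre. *)
Lemma lambda_edge w (t : rat) : nearest w 0 -> ordC w = ratr t -> 0 <= t <= 1 ->
  on_edge (std_vertex k 0) (std_vertex k (-1)) (ratr t) (lambda w).
Proof.
move=> w_near wt t01; have w0 := Omega_subr_neq0 w 0.
have absw : abs_i iota ord w = absv k ord w.
  by rewrite (abs_i_nearest C_inf w_near) rmorph0 subr0.
split.
- by apply: adjacent_sym; exact: adjacent_std_vertex.
- by case/andP: t01 => t0 t1; rewrite ler0q t0 -(rmorph1 ratr) ler_rat.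
have : [set z : C | absv k ord z = abs_i iota ord z /\
    abs_i iota ord z = q_of R k `^ (- ratr t)] (w : C).
  by rewrite /= absw; split=> //; rewrite (absvE C_inf) ?wt//;
    move: w0; rewrite rmorph0 subr0.
by rewrite -(building_fibre lambdaP t01) => -[w' /Omega_eq ->].
Qed.

Definition linear_form (a : P1 k) (z : C) : C :=
  iota (P1_row a 0 0) * z + iota (P1_row a 0 1).

Lemma linear_form_neq0 a z : linear_form a z != 0.
Proof.
rewrite /linear_form !mxE /=; case: a => [x|].
  by rewrite rmorph1 mul1r rmorphN Omega_subr_neq0.
by rewrite rmorph0 mul0r add0r rmorph1 oner_neq0.
Qed.

Lemma s_coefE a b z : s_coef iota a b z =
  - (iota (\det (P1_mx a b)) / (linear_form a z * linear_form b z)).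
Proof.
have la := linear_form_neq0 a z; have lb := linear_form_neq0 b z.
apply: (mulIf (mulf_neq0 la lb)); rewrite mulNr divfK ?mulf_neq0//.
rewrite det_I2 !mxE /= /s_coef; move: la lb; rewrite /linear_form !mxE /=.
case: a b => [x|] [y|]; rewrite /= !(rmorph0, rmorph1, rmorphN, mul0r, mul1r, add0r,
    mulr1, mulr0, subr0, sub0r, oppr0, opprK);
  rewrite ?(rmorphB, rmorphD, rmorphN, rmorph0, rmorph1, opprK) => la lb;
  by field; rewrite ?la ?lb.
Qed.

Lemma ord_s_coef a b z : P1_mx a b \in unitmx ->
  ord (s_coef iota a b z) =
    ((ordL (\det (P1_mx a b)))%:~R - ordC (linear_form a z) - ordC (linear_form b z))%:E.
Proof.
move=> Eu; have la := linear_form_neq0 a z; have lb := linear_form_neq0 b z.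
have dE := det_unitmx_neq0 Eu.
rewrite s_coefE (ordN C_inf) (ordE C_inf); last first.
  by rewrite mulf_neq0 ?invr_neq0 ?mulf_neq0 ?fmorph_eq0.
rewrite (ordCM C_inf) ?invr_neq0 ?mulf_neq0 ?fmorph_eq0// (ordCV C_inf) ?mulf_neq0//.
by rewrite (ordCM C_inf)// (ordC_iota C_inf)// opprD addrA.
Qed.

(** By equivariance [lambda z] is on the edge from [g v_0] to [g v_{-1}], whose matrices are
    [X = E g] and [X diag(pi, 1)]. Row orders interpolate to the orders of the linear forms at [z],
    and the order of the determinant to [ord det E + m + t], where [m + t = ord (z - x)]. *)
Lemma linext_lambda a b z x (Eu : P1_mx a b \in unitmx) : nearest z x ->
  linext (vdefectR R (P1_mx a b)) (lambda z) =
    (ordL (\det (P1_mx a b)))%:~R - ordC (linear_form a z) - ordC (linear_form b z)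
    + ordC ((z : C) - iota x).
Proof.
move=> zx; have [m [x' [w [t [gw zx' w_near wt t01]]]]] := Omega_reduction z.
set g := affine x' _ in gw.
have zE : iota (unif ^ m) * (w : C) + iota x' = (z : C) by rewrite -gw affine_act.
have ord_zx : ordC ((z : C) - iota x) = m%:~R + ratr t.
  (* Both [x] and [x'] are nearest to [z], hence equally close. *)
  have -> : ordC ((z : C) - iota x) = ordC ((z : C) - iota x').
    by apply: le_anti; rewrite zx zx'.
  have w0 : (w : C) != 0 by have := Omega_subr_neq0 w 0; rewrite rmorph0 subr0.
  rewrite -zE addrK (ordCM C_inf) ?fmorph_eq0 ?uniformizer_exp_neq0// wt.
  by rewrite (ordC_iota C_inf) ?uniformizer_exp_neq0// ordL_uniformizer_exp.
have tR : 0 <= (ratr t : R) <= 1.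
  by case/andP: t01 => t0 t1; rewrite ler0q t0 -(rmorph1 ratr) ler_rat.
rewrite -gw (building_equivariant lambdaP)
  (linextE _ (act_on_edge g (lambda_edge w_near wt t01))).
rewrite gw /vdefectR !(vdefect_act_std Eu) oppr0 opprK std_mx0 mulmx1.
have Xu : P1_mx a b *m g \in unitmx by rewrite unitmx_mul Eu GL2_unit.
have Xg i j : (P1_mx a b *m g) i j =
    P1_mx a b i 0 * affine_mx (unif ^ m) x' 0 j +
    P1_mx a b i 1 * affine_mx (unif ^ m) x' 1 j.
  by rewrite mxE big_I2.
have dX : ordL (\det (P1_mx a b *m g)) = ordL (\det (P1_mx a b)) + m.
  rewrite det_mulmx det_affine_mx ordLM ?det_unitmx_neq0 ?uniformizer_exp_neq0//.
  by rewrite ordL_uniformizer_exp.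
move: (P1_mx a b *m g) Xu Xg dX => X Xu Xg dX.
have dX1 : ordL (\det (X *m std_mx k 1)) = ordL (\det X) + 1.
  rewrite det_mulmx det_std_mx ordLM ?det_unitmx_neq0 ?uniformizer_exp_neq0//.
  by rewrite ordL_uniformizer_exp.
have row_ord (i : 'I_2) (y : P1 k) : row i (P1_mx a b) = P1_row y ->
    ordC (linear_form y z) =
    (1 - ratr t) * (rowval (row i X))%:~R + ratr t * (rowval (row i (X *m std_mx k 1)))%:~R.
  move=> Ei; rewrite -(ordC_rowval w_near wt tR (v := row i X)); first last.
  - by rewrite mxE mul_mx_std mulr1 mxE.
  - by rewrite mxE mul_mx_std expr1z mxE.
  - exact: row_unitmx_neq0.
  (* Since [g] is affine, the form of [y] at [z = g w] is the form with row [e_y g] at [w], without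
     denominator. *)
  congr ordC; rewrite /linear_form -Ei !mxE !Xg !mxE /= -zE.
  by rewrite !rmorphD !rmorphM rmorph0 rmorph1; ring.
rewrite (row_ord 0 a (row_P1_mx a b).1) (row_ord 1 b (row_P1_mx a b).2).
rewrite /defect dX1 dX ord_zx !intrB !intrD.
by ring.
Qed.

End BuildingMap.

Theorem proposition2p2p2 (R : realType) (k : finFieldType) (odd_q : odd #|k|)
    (C : fieldType) (iota : {rmorphism laurent k -> C}) (ord : C -> \bar R)
    (C_inf : is_Cinf iota ord)
    (lambda : Omega iota -> treeR R k) (lambdaP : is_building_map ord lambda)
    (a b : P1 k) (a_neq_b : a <> b) (z : Omega iota) :
  ord_form iota ord 1 (s_coef iota a b) z =
    (dist_to_set (lambda z) (geodesic a b))%:E.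
Proof.
have Eu := P1_mx_unit a_neq_b; have [x zx] := nearest_exists C_inf z.
rewrite (dist_to_geodesic Eu) (linext_lambda C_inf lambdaP Eu zx) /ord_form.
rewrite (ord_s_coef C_inf z Eu) (abs_i_nearest C_inf zx).
(* [log_q |z|_i] is [- ord (z - x)], whence the plus sign in front of [ord (z - x)]. *)
by rewrite (log_q_absv C_inf) ?Omega_subr_neq0// mul1r -EFinB opprK.
Qed.
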